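(* Let $\Lambda$ be a locally convex, row-finite $k$-graph and let $R$ be a commutative ring with $1$. Then (a) $\mathrm{KP}_R(\Lambda)$ is basically simple if and only if $\Lambda$ is cofinal and aperiodic; (b) $\mathrm{KP}_R(\Lambda)$ is simple if and only if $\Lambda$ is cofinal and aperiodic, and $R$ is a field.
   Context: $\mathbb N=\{0,1,2,\dots\}$, $k\geq 1$ is an integer, $e_1,\dots,e_k$ is the standard basis of $\mathbb N^k$, and $\leq$ on $\mathbb N^k$ is coordinatewise. A $k$-graph is a countable category $\Lambda$ with a functor $d:\Lambda\to\mathbb N^k$ (degree) satisfying the factorisation property: if $d(\lambda)=m+n$ with $m,n\in\mathbb N^k$, there are unique $\mu,\nu\in\Lambda$ with $d(\mu)=m$, $d(\nu)=n$, $\lambda=\mu\nu$. Morphisms are called paths; the set $\Lambda^0$ of objects (vertices) is identified with the set of paths of degree $0$; $r,s:\Lambda\to\Lambda^0$ are the codomain (range) and domain (source) maps, so $\lambda\mu$ is defined iff $s(\lambda)=r(\mu)$. Write $\Lambda^n=d^{-1}(n)$, $\Lambda^{\neq0}=\Lambda\setminus\Lambda^0$, $v\Lambda=\{\lambda:r(\lambda)=v\}$, $v\Lambda^n=v\Lambda\cap\Lambda^n$, $v\Lambda w=\{\lambda\in v\Lambda:s(\lambda)=w\}$. $\Lambda$ is row-finite if every $v\Lambda^n$ is finite. $\Lambda$ is locally convex if for all $v\in\Lambda^0$, $i\neq j$, $\lambda\in v\Lambda^{e_i}$, $\mu\in v\Lambda^{e_j}$, the sets $s(\lambda)\Lambda^{e_j}$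 and $s(\mu)\Lambda^{e_i}$ are nonempty. For $n\in\mathbb N^k$, $\Lambda^{\leq n}=\{\lambda\in\Lambda: d(\lambda)\leq n,\text{ and } d(\lambda)_i<n_i\text{ implies } s(\lambda)\Lambda^{e_i}=\emptyset\}$, and $v\Lambda^{\leq n}=v\Lambda\cap\Lambda^{\leq n}$. Boundary paths: for $m\in(\mathbb N\cup\{\infty\})^k$ let $\Omega_{k,m}$ be the $k$-graph with objects $\{p\in\mathbb N^k:p\leq m\}$, morphisms $(p,q)$ with $p\leq q\leq m$, $r(p,q)=p$, $s(p,q)=q$, $d(p,q)=q-p$. A boundary path of degree $m$ is a degree-preserving functor $x:\Omega_{k,m}\to\Lambda$ such that whenever $p\leq m$ and $p_i=m_i$ we have $x(p)\Lambda^{e_i}=\emptyset$, where $x(p):=x(p,p)$. Write $d(x)=m$, $r(x)=x(0)$; $\Lambda^{\leq\infty}$ is the set of boundary paths and $v\Lambda^{\leq\infty}=\{x\in\Lambda^{\leq\infty}:r(x)=v\}$. If $s(\lambda)=r(x)$, $\lambda x$ is the boundary path of degree $d(\lambda)+d(x)$ with $(\lambda x)(0,d(\lambda))=\lambda$ and $(\lambda x)(d(\lambda)+p,d(\lambda)+q)=x(p,q)$. $\Lambda$ is cofinal if for every $x\in\Lambda^{\leq\infty}$ and every $v\in\Lambda^0$ there exists $n\in\mathbb N^k$ with $n\leq d(x)$ and $v\Lambda x(n)\neq\emptyset$. $\Lambda$ is aperiodic if for every $v\in\Lambda^0$ there exists $x\in v\Lambda^{\leq\infty}$ such that for $\alpha,\beta\in\Lambda$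 with $s(\alpha)=s(\beta)=v$, $\alpha\neq\beta$ implies $\alpha x\neq\beta x$. Kumjian-Pask families: for each $\lambda\in\Lambda^{\neq 0}$ let $\lambda^*$ be a formal symbol; for $v\in\Lambda^0$ put $v^*=v$. $R$-algebras are associative but need not be unital. A Kumjian-Pask $\Lambda$-family $(P,S)$ in an $R$-algebra $A$ consists of elements $P_v$ ($v\in\Lambda^0$), $S_\lambda,S_{\lambda^*}$ ($\lambda\in\Lambda^{\neq0}$) of $A$ such that, with the convention $S_v=S_{v^*}=P_v$: (KP1) $P_vP_w=\delta_{v,w}P_v$; (KP2) $S_\lambda S_\mu=S_{\lambda\mu}$ and $S_{\mu^*}S_{\lambda^*}=S_{(\lambda\mu)^*}$ when $r(\mu)=s(\lambda)$, and $P_{r(\lambda)}S_\lambda=S_\lambda=S_\lambda P_{s(\lambda)}$, $P_{s(\lambda)}S_{\lambda^*}=S_{\lambda^*}=S_{\lambda^*}P_{r(\lambda)}$; (KP3$'$) $S_{\lambda^*}S_\mu=\delta_{\lambda,\mu}P_{s(\lambda)}$ for all $n\in\mathbb N^k\setminus\{0\}$ and $\lambda,\mu\in\Lambda^{\leq n}$; (KP4$'$) $P_v=\sum_{\lambda\in v\Lambda^{\leq n}}S_\lambda S_{\lambda^*}$ for all $v\in\Lambda^0$, $n\in\mathbb N^k\setminus\{0\}$. $\mathrm{KP}_R(\Lambda)$ is the $R$-algebra generated by a universal Kumjian-Pask $\Lambda$-family $(p,s)$: for every Kumjian-Pask $\Lambda$-family $(Q,T)$ in an $R$-algebra $A$ there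 is a unique $R$-algebra homomorphism $\mathrm{KP}_R(\Lambda)\to A$ carrying $(p,s)$ to $(Q,T)$. An ideal $I$ of $\mathrm{KP}_R(\Lambda)$ is basic if $rp_v\in I$ for some $v\in\Lambda^0$ and $r\in R\setminus\{0\}$ implies $p_v\in I$. $\mathrm{KP}_R(\Lambda)$ is basically simple if its only basic ideals are $\{0\}$ and $\mathrm{KP}_R(\Lambda)$. Ideals are two-sided, and ''simple'' has its usual ring-theoretic meaning.
   Formalization: R is assumed nonzero (for R = 0 the algebra is 0 and (a) fails when Λ is not cofinal), and in (b) Λ is assumed to have at least one vertex (for empty Λ the algebra is 0 and (b) fails under either convention on whether 0 is simple). *)

(* Defs.v *)
From HB Require Import structures.
From mathcomp Require Import all_boot all_order all_algebra.
From mathcomp Require Import boolp classical_sets cardinality fsbigop.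

Set Implicit Arguments.
Unset Strict Implicit.
Unset Printing Implicit Defensive.

Import GRing.Theory.

Local Open Scope classical_set_scope.
Local Open Scope ring_scope.

(** * Degrees *)

(* [deg k] carries the pointwise additive structure of [{ffun 'I_k -> nat}]. *)
Definition deg (k : nat) := {ffun 'I_k -> nat}.

Definition ddelta (k : nat) (i : 'I_k) : deg k := [ffun j => (j == i : nat)].

Definition dle (k : nat) (m n : deg k) : bool := [forall i, (m i <= n i)%N].

(* Elements of (N u {oo})^k; [None] is oo. *)
Definition edeg (k : nat) := {ffun 'I_k -> option nat}.

Definition dlee (k : nat) (p : deg k) (m : edeg k) : bool :=
  [forall i, if m i is Some b then (p i <= b)%N else true].

Definition daddee (k : nat) (n : deg k) (m : edeg k) : edeg k :=
  [ffun i => omap (addn (n i)) (m i)].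

(** * k-graphs *)

(* Vertices are a separate type, embedded as identity paths by [pid]; by the
   factorisation property these are exactly the paths of degree 0.
   Composition is a total function, constrained only on composable pairs. *)
Record kgraph (k : nat) := KGraph {
  vertex : countType;
  path : countType;
  rng : path -> vertex;
  src : path -> vertex;
  pid : vertex -> path;
  pcomp : path -> path -> path;
  pdeg : path -> deg k;
  rng_pid : forall v, rng (pid v) = v;
  src_pid : forall v, src (pid v) = v;
  rng_pcomp : forall x y, src x = rng y -> rng (pcomp x y) = rng x;
  src_pcomp : forall x y, src x = rng y -> src (pcomp x y) = src y;
  pcompA : forall x y z, src x = rng y -> src y = rng z ->
    pcomp x (pcomp y z) = pcomp (pcomp x y) z;
  pcomp1p : forall x, pcomp (pid (rng x)) x = x;
  pcompp1 : forall x, pcomp x (pid (src x)) = x;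
  pdeg_pid : forall v, pdeg (pid v) = 0;
  pdeg_pcomp : forall x y, src x = rng y -> pdeg (pcomp x y) = pdeg x + pdeg y;
  factorisation : forall x (m n : deg k), pdeg x = m + n ->
    exists! yz : path * path,
      [/\ pdeg yz.1 = m, pdeg yz.2 = n, src yz.1 = rng yz.2
        & x = pcomp yz.1 yz.2]
}.

Arguments pid {k} _ _.

Section KGraphNotions.
Variables (k : nat) (L : kgraph k).
Implicit Types (v : vertex L) (x y z : path L).

Definition paths_from v (n : deg k) : set (path L) :=
  [set x | rng x = v /\ pdeg x = n].

Definition row_finite := forall v n, finite_set (paths_from v n).

Definition locally_convex :=
  forall v (i j : 'I_k), i != j -> forall x y,
    paths_from v (ddelta i) x -> paths_from v (ddelta j) y ->
    paths_from (src x) (ddelta j) !=set0 /\ paths_from (src y) (ddelta i) !=set0.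

Definition le_paths (n : deg k) : set (path L) :=
  [set x | dle (pdeg x) n /\
    forall i, (pdeg x i < n i)%N -> paths_from (src x) (ddelta i) = set0].

Definition le_paths_from v (n : deg k) : set (path L) :=
  [set x | rng x = v /\ le_paths n x].

(* A boundary path [x] of degree m is the family of its values x(p, q) for
   p <= q <= m, i.e. for the morphisms (p, q) of Omega_{k,m}; the values of
   [bp_seg] at other pairs are unconstrained and are never used, and equality
   of boundary paths is [bp_eq]. *)
Definition bp_ob (seg : deg k -> deg k -> path L) (p : deg k) : vertex L :=
  rng (seg p p).

Record boundary_path := BoundaryPath {
  bp_deg : edeg k;
  bp_seg : deg k -> deg k -> path L;
  bp_seg_deg : forall p q, dle p q -> dlee q bp_deg -> p + pdeg (bp_seg p q) = q;
  bp_seg_rng : forall p q, dle p q -> dlee q bp_deg ->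
    rng (bp_seg p q) = bp_ob bp_seg p;
  bp_seg_src : forall p q, dle p q -> dlee q bp_deg ->
    src (bp_seg p q) = bp_ob bp_seg q;
  bp_seg_id : forall p, dlee p bp_deg -> bp_seg p p = pid L (bp_ob bp_seg p);
  bp_seg_comp : forall p q t, dle p q -> dle q t -> dlee t bp_deg ->
    pcomp (bp_seg p q) (bp_seg q t) = bp_seg p t;
  bp_boundary : forall p i, dlee p bp_deg -> bp_deg i = Some (p i) ->
    paths_from (bp_ob bp_seg p) (ddelta i) = set0
}.

Definition bp_at (x : boundary_path) (p : deg k) : vertex L :=
  bp_ob (bp_seg x) p.

Definition bp_rng (x : boundary_path) : vertex L := bp_at x 0.

Definition bp_eq (x y : boundary_path) : Prop :=
  bp_deg x = bp_deg y /\
  forall p q, dle p q -> dlee q (bp_deg x) -> bp_seg x p q = bp_seg y p q.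

(* [is_concat a x y]: [y] is the boundary path [a x] (where s(a) = r(x)). *)
Definition is_concat (a : path L) (x y : boundary_path) : Prop :=
  [/\ bp_deg y = daddee (pdeg a) (bp_deg x),
      bp_seg y 0 (pdeg a) = a
    & forall p q, dle p q -> dlee q (bp_deg x) ->
        bp_seg y (pdeg a + p) (pdeg a + q) = bp_seg x p q].

Definition cofinal :=
  forall (x : boundary_path) v, exists2 n : deg k, dlee n (bp_deg x) &
    exists a : path L, rng a = v /\ src a = bp_at x n.

Definition aperiodic :=
  forall v, exists2 x : boundary_path, bp_rng x = v &
    forall a b : path L, src a = v -> src b = v -> a <> b ->
    forall ax bx, is_concat a x ax -> is_concat b x bx -> ~ bp_eq ax bx.

End KGraphNotions.

(** * Associative, not necessarily unital, algebras *)

HB.mixin Record Lmodule_isNUAlgebra (R : comNzRingType) A of GRing.Lmodule R A := {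
  numul : A -> A -> A;
  numulA : associative numul;
  numulDl : left_distributive numul +%R;
  numulDr : right_distributive numul +%R;
  nuscaleAl : forall (c : R) (x y : A), c *: numul x y = numul (c *: x) y;
  nuscaleAr : forall (c : R) (x y : A), c *: numul x y = numul x (c *: y)
}.

#[short(type="nuAlgType")]
HB.structure Definition NUAlgebra (R : comNzRingType) :=
  {A of GRing.Lmodule R A & Lmodule_isNUAlgebra R A}.

Notation "x ** y" := (numul x y) (at level 40, left associativity) : ring_scope.

Definition nualg_hom (R : comNzRingType) (A B : nuAlgType R) (f : A -> B) : Prop :=
  linear f /\ forall x y, f (x ** y) = f x ** f y.

(** * Kumjian-Pask families *)

Section KumjianPask.
Variables (k : nat) (L : kgraph k) (R : comNzRingType).

(* [kpS] and [kpT] give S_a and S_{a^*}; by [kpS_pid] and [kpT_pid] they follow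
   the convention S_v = S_{v^*} = P_v at identity paths.  The sum in [kp4] is
   over a set which is finite when [L] is row-finite. *)
Record KP_family (A : nuAlgType R) := KPFamily {
  kpP : vertex L -> A;
  kpS : path L -> A;
  kpT : path L -> A;
  kpS_pid : forall v, kpS (pid L v) = kpP v;
  kpT_pid : forall v, kpT (pid L v) = kpP v;
  kp1 : forall v w, kpP v ** kpP w = if v == w then kpP v else 0;
  kp2S : forall a b, src a = rng b -> kpS a ** kpS b = kpS (pcomp a b);
  kp2T : forall a b, src a = rng b -> kpT b ** kpT a = kpT (pcomp a b);
  kp2PS : forall a, kpP (rng a) ** kpS a = kpS a;
  kp2SP : forall a, kpS a ** kpP (src a) = kpS a;
  kp2PT : forall a, kpP (src a) ** kpT a = kpT a;
  kp2TP : forall a, kpT a ** kpP (rng a) = kpT a;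
  kp3 : forall n : deg k, n != 0 -> forall a b, le_paths n a -> le_paths n b ->
    kpT a ** kpS b = if a == b then kpP (src a) else 0;
  kp4 : forall v (n : deg k), n != 0 ->
    kpP v = \sum_(a \in le_paths_from v n) (kpS a ** kpT a)
}.

Definition KP_carries (A B : nuAlgType R) (F : KP_family A) (G : KP_family B)
    (f : A -> B) : Prop :=
  [/\ forall v, f (kpP F v) = kpP G v,
      forall a, f (kpS F a) = kpS G a
    & forall a, f (kpT F a) = kpT G a].

(* [KP_universal F] says that [A], with the family [F], is KP_R(L). *)
Definition KP_universal (A : nuAlgType R) (F : KP_family A) : Prop :=
  forall (B : nuAlgType R) (G : KP_family B),
    exists2 f : A -> B, nualg_hom f /\ KP_carries F G f &
      forall g : A -> B, nualg_hom g -> KP_carries F G g -> g =1 f.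

End KumjianPask.

(** * Ideals and simplicity *)

Section Simplicity.
Variables (R : comNzRingType) (A : nuAlgType R).

(* Two-sided ring ideals.  Closure under scalars is not imposed: it is
   automatic in KP_R(L), which has local units. *)
Definition is_ideal (I : set A) : Prop :=
  [/\ I 0,
      forall x y, I x -> I y -> I (x - y),
      forall x y, I y -> I (x ** y)
    & forall x y, I x -> I (x ** y)].

(* The usual notion for rings without unit: nonzero multiplication, and no
   ideals but the two trivial ones. *)
Definition simple_alg : Prop :=
  (exists x y : A, x ** y <> 0) /\
  forall I : set A, is_ideal I -> I = [set 0] \/ I = setT.

Variables (k : nat) (L : kgraph k) (F : KP_family L A).

Definition basic_ideal (I : set A) : Prop :=
  is_ideal I /\
  forall v (c : R), c != 0 -> I (c *: kpP F v) -> I (kpP F v).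

Definition basically_simple : Prop :=
  forall I : set A, basic_ideal I -> I = [set 0] \/ I = setT.

End Simplicity.

(* For a ring which is nontrivial by its type. *)
Definition is_field (R : comNzRingType) : Prop :=
  forall c : R, c != 0 -> exists d : R, d * c = 1.

(* Main.v *)
(** A boundary path is determined by the set of its finite initial segments;
    these sets are the prefix-closed directed sets of paths that meet every
    [Lambda^{<= n}], and prefixing and shifting act on them.  The algebra
    KP_R(L) acts by weighted composition operators on the functions on any
    invariant set of boundary paths, and the kernel of such a representation is
    a basic ideal.  If L is not cofinal, the boundary paths that avoid a suitable
    hereditary set of vertices give a proper nonzero kernel.  If L is not
    aperiodic, a Baire category argument gives paths [a <> b] with [a x = b x]
    for all boundary paths [x], so that [s_a - s_b] is in the kernel of the full
    representation, while a twist of this representation by the degree shows that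
    [s_a <> s_b].

    Conversely, a nonzero element of an ideal is a combination of elements
    [s_a t_b] in which every [b] is in one [Lambda^{<= m}].  Multiplying by [s_b]
    on the right leaves a combination of elements [s_a], and compressing by an
    initial segment of an aperiodic boundary path leaves a nonzero multiple of a
    vertex.  A basic ideal then contains a vertex, and by cofinality all of them:
    otherwise its complement carries a boundary path that avoids it. *)

From HB Require Import structures.
From mathcomp Require Import all_boot all_order all_algebra.
From mathcomp Require Import boolp classical_sets functions cardinality fsbigop.
From mathcomp Require Import zify.
Require Import Defs.

Set Implicit Arguments.
Unset Strict Implicit.
Unset Printing Implicit Defensive.

Import GRing.Theory.

Local Open Scope classical_set_scope.
Local Open Scope ring_scope.

(** * Degrees and paths *)

Section Degrees.
Variable k : nat.
Implicit Types m n p : deg k.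

Definition dsub m n : deg k := [ffun i => (m i - n i)%N].
Definition dmin m n : deg k := [ffun i => minn (m i) (n i)].
Definition dconst (j : nat) : deg k := [ffun => j].

Lemma degP m n : (forall i, m i = n i :> nat) -> m = n.
Proof. by move=> h; apply/ffunP. Qed.

Lemma degD m n i : (m + n) i = (m i + n i)%N.
Proof. by rewrite ffunE. Qed.

Lemma deg0 i : (0 : deg k) i = 0%N.
Proof. by rewrite ffunE. Qed.

Definition degE := (degD, deg0, ffunE).

Lemma dleP m n : reflect (forall i, (m i <= n i)%N) (dle m n).
Proof. exact: forallP. Qed.

Lemma dle_refl m : dle m m.
Proof. by apply/dleP. Qed.

Lemma dle_trans n m p : dle m n -> dle n p -> dle m p.
Proof. by move=> /dleP h1 /dleP h2; apply/dleP => i; exact: leq_trans (h1 i) (h2 i). Qed.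

Lemma dle_anti m n : dle m n -> dle n m -> m = n.
Proof.
by move=> /dleP h1 /dleP h2; apply: degP => i; apply/eqP; rewrite eqn_leq h1 h2.
Qed.

Lemma dle0 m : dle 0 m.
Proof. by apply/dleP => i; rewrite deg0. Qed.

Lemma dle_addr m n : dle m (m + n).
Proof. by apply/dleP => i; rewrite degD leq_addr. Qed.

Lemma dle_addl m n : dle m (n + m).
Proof. by apply/dleP => i; rewrite degD leq_addl. Qed.

Lemma dle_add2 m n p : dle (m + n) (m + p) = dle n p.
Proof. by apply/dleP/dleP => h i; have := h i; rewrite !degD leq_add2l. Qed.

Lemma dsubK m n : dle m n -> m + dsub n m = n.
Proof. by move=> /dleP h; apply: degP => i; rewrite !degE subnKC. Qed.

Lemma daddK m n : dsub (m + n) m = n.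
Proof. by apply: degP => i; rewrite !degE addKn. Qed.

Lemma dminl m n : dle (dmin m n) m.
Proof. by apply/dleP => i; rewrite ffunE geq_minl. Qed.

Lemma dminr m n : dle (dmin m n) n.
Proof. by apply/dleP => i; rewrite ffunE geq_minr. Qed.

Lemma dadd_inj m n p : m + n = m + p -> n = p.
Proof. by move=> e; rewrite -(daddK m n) e daddK. Qed.

Lemma dle_ddelta m i : (0 < m i)%N -> dle (ddelta i) m.
Proof.
move=> h; apply/dleP => j; rewrite ffunE; case: eqP => [->|_] //=.
Qed.

Lemma deg_neq0 m : m != 0 -> exists i, (0 < m i)%N.
Proof.
move=> m0; apply/existsP; apply: contraNT m0; rewrite negb_exists => /forallP h.
by apply/eqP/degP => i; have := h i; rewrite deg0; lia.
Qed.

Lemma dsum_ddelta_add m i : (\sum_j (ddelta i + m)%R j = (\sum_j m j).+1)%N.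
Proof.
under eq_bigr => j _ do rewrite degD.
rewrite big_split /= (bigD1 i) //= !ffunE eqxx big1 ?addn0 ?add1n // => j ji.
by rewrite ffunE (negbTE ji).
Qed.

End Degrees.

(** * Prefixes, blocked directions and the sets [le_paths n] *)

Section Combinatorics.
Variables (k : nat) (L : kgraph k).
Implicit Types (a b c x y z : path L) (u v w : vertex L) (m n p : deg k).

Lemma pcomp_inj a b a' b' : src a = rng b -> src a' = rng b' ->
  pdeg a = pdeg a' -> pcomp a b = pcomp a' b' -> a = a' /\ b = b'.
Proof.
move=> ab ab' da e.
have dd : pdeg b = pdeg b'.
  by apply: (@dadd_inj _ (pdeg a)); rewrite -pdeg_pcomp // e pdeg_pcomp // da.
have [yz [_ U]] := factorisation (pdeg_pcomp ab).
have e1 := U (a, b) (And4 erefl erefl ab erefl).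
have e2 := U (a', b') (And4 (esym da) (esym dd) ab' e).
by move: e2; rewrite e1 => -[-> ->].
Qed.

Lemma pcomp_injl a b b' : src a = rng b -> src a = rng b' ->
  pcomp a b = pcomp a b' -> b = b'.
Proof. by move=> h h' /(pcomp_inj h h' erefl) []. Qed.

Lemma pcomp_injr a a' b : src a = rng b -> src a' = rng b ->
  pcomp a b = pcomp a' b -> a = a'.
Proof.
move=> h h' e; apply: (proj1 (pcomp_inj h h' _ e)).
apply: (@dadd_inj _ (pdeg b)).
by rewrite addrC [RHS]addrC -!pdeg_pcomp // e.
Qed.

Lemma pdeg0_pid a : pdeg a = 0 -> a = pid L (rng a).
Proof.
move=> a0.
apply/esym; apply: (proj1 (@pcomp_inj _ a _ (pid L (src a)) _ _ _ _)).
- by rewrite src_pid.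
- by rewrite rng_pid.
- by rewrite pdeg_pid.
- by rewrite pcomp1p pcompp1.
Qed.

Lemma path_split a m : dle m (pdeg a) ->
  exists b c, [/\ src b = rng c, a = pcomp b c & pdeg b = m].
Proof.
move=> /dsubK /esym /factorisation [[b c] [[/= h1 h2 h3 h4] _]].
by exists b, c.
Qed.

Definition prefix a b := exists2 c, src a = rng c & b = pcomp a c.

Lemma prefix_refl a : prefix a a.
Proof. by exists (pid L (src a)); rewrite ?rng_pid ?pcompp1. Qed.

Lemma prefix_trans b a c : prefix a b -> prefix b c -> prefix a c.
Proof.
move=> [x ax ->] [y]; rewrite src_pcomp // => xy ->.
by exists (pcomp x y); rewrite ?rng_pcomp // pcompA.
Qed.

Lemma prefix_pcomp a b : src a = rng b -> prefix a (pcomp a b).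
Proof. by exists b. Qed.

Lemma prefix_pcomp2 a b c : src a = rng b -> prefix b c ->
  prefix (pcomp a b) (pcomp a c).
Proof. by move=> ab [x bx ->]; exists x; rewrite ?src_pcomp // pcompA. Qed.

Lemma prefix_rng a b : prefix a b -> rng b = rng a.
Proof. by move=> [x ax ->]; rewrite rng_pcomp. Qed.

Lemma prefix_dle a b : prefix a b -> dle (pdeg a) (pdeg b).
Proof. by move=> [x ax ->]; rewrite pdeg_pcomp // dle_addr. Qed.

Lemma prefix_pid a : prefix (pid L (rng a)) a.
Proof. by exists a; rewrite ?src_pid // pcomp1p. Qed.

Lemma prefix_total a b c : prefix a c -> prefix b c ->
  dle (pdeg a) (pdeg b) -> prefix a b.
Proof.
move=> [x ax ->] [y by_ e] /path_split [a' [z [a'z bE da]]].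
have yz : src z = rng y by rewrite -by_ bE src_pcomp.
move: e; rewrite bE -pcompA // => /pcomp_inj [] //.
- by rewrite rng_pcomp.
- by move=> -> _; exists z.
Qed.

Lemma prefix_eqdeg a b c : prefix a c -> prefix b c -> pdeg a = pdeg b -> a = b.
Proof.
by move=> [x ax ->] [y by_ e] d; have [] := pcomp_inj ax by_ d e.
Qed.

Lemma truncate a m : exists2 b, prefix b a & pdeg b = dmin (pdeg a) m.
Proof.
have [b [c [bc -> <-]]] := path_split (dminl (pdeg a) m).
by exists b => //; exists c.
Qed.

Definition blocked v (i : 'I_k) := forall a, rng a = v -> pdeg a <> ddelta i.

Lemma blockedP v i : blocked v i <-> paths_from v (ddelta i) = set0.
Proof.
split=> [h|h a ra da]; last first.
  by have : paths_from v (ddelta i) a by []; rewrite h.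
by apply/seteqP; split=> // a [ra da]; have := h _ ra da.
Qed.

Lemma blocked_deg v i a : blocked v i -> rng a = v -> pdeg a i = 0%N.
Proof.
move=> bl ra; apply/eqP; rewrite -leqn0 leqNgt; apply/negP => /dle_ddelta.
move=> /path_split [b [c [bc e db]]]; apply: bl db.
by rewrite -ra e rng_pcomp.
Qed.

Lemma blocked_src a i : blocked (rng a) i -> blocked (src a) i.
Proof.
move=> bl b rb db.
have := blocked_deg bl (a := pcomp a b); rewrite rng_pcomp // => /(_ erefl).
by rewrite pdeg_pcomp // db !degE eqxx addn1.
Qed.

Lemma le_pathsP n a : le_paths n a <->
  dle (pdeg a) n /\ forall i, (pdeg a i < n i)%N -> blocked (src a) i.
Proof.
by split=> -[h1 h2]; split=> // i hi; apply/blockedP; apply: h2.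
Qed.

Lemma le_paths_deg a : le_paths (pdeg a) a.
Proof. by apply/le_pathsP; split=> [|i]; rewrite ?dle_refl ?ltnn. Qed.

Lemma le_paths_pcomp m n a b : le_paths m a -> le_paths n b -> src a = rng b ->
  le_paths (m + n) (pcomp a b).
Proof.
move=> /le_pathsP [/dleP d1 h1] /le_pathsP [/dleP d2 h2] ab; apply/le_pathsP.
rewrite pdeg_pcomp // src_pcomp //; split.
  by apply/dleP => i; rewrite !degD leq_add.
move=> i; rewrite !degD => lt.
case: (ltnP (pdeg b i) (n i)) => [/h2 //|h].
apply: blocked_src; rewrite -ab; apply: h1.
by have := d2 i; lia.
Qed.

Lemma le_paths_suffix m a b : src a = rng b -> le_paths (pdeg a + m) (pcomp a b) ->
  le_paths m b.
Proof.
move=> ab /le_pathsP; rewrite pdeg_pcomp // src_pcomp // dle_add2 => -[d h].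
by apply/le_pathsP; split=> // i hi; apply: h; rewrite !degD ltn_add2l.
Qed.

(* If [d(b)_i > d(a)_i] then [d(a)_i < n_i], so no path leaves [s(a)] in
   direction [i] and no extension of [a] can have [b] as a prefix. *)
Lemma le_paths_max n a b c : le_paths n a -> prefix a c -> prefix b c ->
  dle (pdeg b) n -> prefix b a.
Proof.
move=> /le_pathsP [_ h] ac bc /dleP bn; apply: (prefix_total bc ac).
apply/dleP => i; rewrite leqNgt; apply/negP => lt.
have bl := h i (leq_trans lt (bn i)).
case: ac => x ax cE; have := dleP _ _ (prefix_dle bc) i.
by rewrite cE pdeg_pcomp // degD (blocked_deg bl (esym ax)); lia.
Qed.

Lemma le_paths_uniq n a b c : le_paths n a -> le_paths n b ->
  prefix a c -> prefix b c -> a = b.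
Proof.
move=> na nb ac bc.
have [] := (le_pathsP n a).1 na; have [] := (le_pathsP n b).1 nb => dbn _ dan _.
have ab := le_paths_max nb bc ac dan.
have ba := le_paths_max na ac bc dbn.
by apply: (prefix_eqdeg ac bc); apply: dle_anti; apply: prefix_dle.
Qed.

Lemma le_paths_exists v n : exists2 a, rng a = v & le_paths n a.
Proof.
(* Greedy extension of [a] by one edge at a time; [N] bounds the total degree still missing. *)
suff H N a : rng a = v -> dle (pdeg a) n -> (\sum_i (n i - pdeg a i) < N)%N ->
    exists2 b, rng b = v & le_paths n b.
  by apply: (H _ (pid L v)); rewrite ?rng_pid // pdeg_pid dle0.
elim: N a => // N IH a ra dan hN.
have [na|nna] := pselect (le_paths n a); first by exists a.
have [i lti [b rb db]] : exists2 i, (pdeg a i < n i)%N &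
    exists2 b, rng b = src a & pdeg b = ddelta i.
  apply: contrapT => h; apply: nna; apply/le_pathsP; split=> // i lti b rb db.
  by apply: h; exists i => //; exists b.
apply: (IH (pcomp a b)); rewrite ?rng_pcomp // pdeg_pcomp // db.
  apply/dleP => j; rewrite !degE; have := dleP _ _ dan j.
  by case: eqP => [->|_] /=; rewrite ?addn1 ?addn0.
rewrite ltnS in hN; apply: leq_trans hN; rewrite (bigD1 i) //= [ltnRHS](bigD1 i) //= !degE eqxx addn1.
rewrite (eq_bigr (fun j => n j - pdeg a j))%N; first by rewrite -addSn leq_add // subnSK.
by move=> j ji; rewrite !degE (negbTE ji) addn0.
Qed.

Hypothesis hlc : locally_convex L.

(** Local convexity carries an edge of direction [i] at [rng a] past each edge of [a], since none of
    these has direction [i]; it would end as such an edge at [src a]. *)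
Lemma blocked_back a i : pdeg a i = 0%N -> blocked (src a) i -> blocked (rng a) i.
Proof.
have [N] := ubnP (\sum_j pdeg a j)%N; elim: N a => // N IH a hN ai bl.
have [a0|/deg_neq0 [j aj]] := eqVneq (pdeg a) 0.
  by move: bl; rewrite (pdeg0_pid a0) src_pid rng_pid.
have [b [c [bc aE db]]] := path_split (dle_ddelta aj).
have ji : j != i by apply: contraTN aj => /eqP ->; rewrite ai.
move: hN ai bl; rewrite aE pdeg_pcomp // db dsum_ddelta_add src_pcomp // rng_pcomp //.
rewrite ltnS degD => hN /eqP; rewrite addn_eq0 => /andP[_ /eqP ci] bl f rf df.
have [] := hlc (v := rng b) ji (x := b) (y := f); [by []|by []|].
move=> [g [rg dg]] _; apply: (IH c _ ci bl g) => //; by rewrite rg.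
Qed.

(** In a direction where [b] falls short of [m], it already has the full degree of [a]. The rest of
    [a] has degree 0 there, so the block at [src a] moves back to [src b]. *)
Lemma le_paths_truncate m n a b : le_paths n a -> dle m n -> prefix b a ->
  pdeg b = dmin (pdeg a) m -> le_paths m b.
Proof.
move=> /le_pathsP [_ h] /dleP mn [c bc aE] db; apply/le_pathsP.
rewrite db dminr; split=> // i; rewrite ffunE => lt.
have lt' : (pdeg a i < m i)%N by lia.
rewrite bc; apply: blocked_back.
  by have := congr1 (fun f : deg k => f i) db; rewrite ffunE aE pdeg_pcomp // degD;
    move: lt'; rewrite aE pdeg_pcomp // degD; lia.
have -> : src c = src a by rewrite aE src_pcomp.
by apply: h; apply: leq_trans lt' _.
Qed.

End Combinatorics.

(** * Boundary paths as sets of initial segments *)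

Section Ultra.
Variables (k : nat) (L : kgraph k).
Implicit Types (a b c x y z : path L) (u v w : vertex L) (m n p : deg k).
Implicit Types X Y : set (path L).

(* A boundary path is encoded by the set of its finite initial segments. *)
Definition ultra X :=
  [/\ forall a b, X b -> prefix a b -> X a,
      forall a b, X a -> X b -> exists2 c, X c & prefix a c /\ prefix b c
    & forall n, exists2 a, X a & le_paths n a].

(** The initial segments of a x when [X] encodes x; closing under prefixes also adds the segments
    that do not extend [a]. Dually, [shift a] removes [a] from the front. *)
Definition ext a X : set (path L) :=
  [set b | exists c, [/\ X c, src a = rng c & prefix b (pcomp a c)]].

Definition shift a X : set (path L) := [set b | src a = rng b /\ X (pcomp a b)].

Lemma ultra_rng X a b : ultra X -> X a -> X b -> rng a = rng b.
Proof.
by move=> [_ U _] /U h /h [c _ [/prefix_rng <- /prefix_rng <-]].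
Qed.

Lemma ultra_pid X a : ultra X -> X a -> X (pid L (rng a)).
Proof. by move=> [U _ _] Xa; apply: (U _ a) => //; apply: prefix_pid. Qed.

Lemma ultra_src X v a : ultra X -> X (pid L v) -> X a -> rng a = v.
Proof. by move=> U Xv Xa; rewrite (ultra_rng U Xa Xv) rng_pid. Qed.

Lemma ultra_rngP X : ultra X -> exists v, X (pid L v).
Proof. by move=> U; have [_ _ /(_ 0) [a Xa _]] := U; exists (rng a); apply: ultra_pid. Qed.

Lemma ultra_max X n a b : ultra X -> X a -> X b -> le_paths n a ->
  dle (pdeg b) n -> prefix b a.
Proof.
move=> [_ U _] Xa Xb na bn; have [c _ [ac bc]] := U _ _ Xa Xb.
exact: (le_paths_max na ac bc bn).
Qed.

Lemma ultra_uniq X a b : ultra X -> X a -> X b -> pdeg a = pdeg b -> a = b.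
Proof.
move=> [_ U _] Xa Xb; have [c _ [ac bc]] := U _ _ Xa Xb.
exact: prefix_eqdeg ac bc.
Qed.

Lemma ultra_le_uniq X n a b : ultra X -> X a -> X b ->
  le_paths n a -> le_paths n b -> a = b.
Proof.
move=> [_ U _] Xa Xb na nb; have [c _ [ac bc]] := U _ _ Xa Xb.
exact: le_paths_uniq na nb ac bc.
Qed.

Lemma ultra_above X a n : ultra X -> X a ->
  exists2 b, X b & prefix a b /\ le_paths (pdeg a + n) b.
Proof.
move=> U Xa; have [_ _ /(_ (pdeg a + n)) [b Xb nb]] := U.
exists b => //; split=> //; apply: ultra_max U Xb Xa nb _; exact: dle_addr.
Qed.

Lemma ext_self a X : ultra X -> X (pid L (src a)) -> ext a X a.
Proof.
move=> U Xa; exists (pid L (src a)); split=> //; rewrite ?rng_pid //.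
by rewrite pcompp1; apply: prefix_refl.
Qed.

Lemma ext_pcompE a b X : ultra X -> src a = rng b -> ext a X (pcomp a b) <-> X b.
Proof.
move=> [U _ _] ab; split=> [[c [Xc ac [x xb]]]|Xb]; last first.
  by exists b; split=> //; apply: prefix_refl.
rewrite src_pcomp // in xb; rewrite -pcompA // => /pcomp_injl e.
by apply: U Xc _; rewrite e ?rng_pcomp //; exists x.
Qed.

Lemma shift_ext a X : ultra X -> X (pid L (src a)) -> shift a (ext a X) = X.
Proof.
move=> U Xa; apply/seteqP; split=> b /=.
  by move=> [ab /ext_pcompE]; apply.
move=> Xb; have ab : src a = rng b by rewrite (ultra_src U Xa Xb).
by split=> //; apply/ext_pcompE.
Qed.

Lemma ext_shift a X : ultra X -> X a -> ext a (shift a X) = X.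
Proof.
move=> U Xa; have [U1 U2 _] := U; apply/seteqP; split=> b /=.
  by move=> [c [[_ Xc] ac /U1]]; apply.
move=> Xb; have [c Xc [[x ax cE] bc]] := U2 _ _ Xa Xb.
by exists x; rewrite -cE; split=> //; split=> //; rewrite -cE.
Qed.

Lemma ext_pid v X : ultra X -> X (pid L v) -> ext (pid L v) X = X.
Proof.
move=> U Xv; have [U1 _ _] := U; apply/seteqP; split=> b /=.
  move=> [c [Xc]]; rewrite src_pid => ->; rewrite pcomp1p; exact: U1.
move=> Xb; have rb := ultra_src U Xv Xb; exists b; split=> //; rewrite ?src_pid //.
by rewrite -rb pcomp1p; apply: prefix_refl.
Qed.

Lemma shift_pid v X : ultra X -> X (pid L v) -> shift (pid L v) X = X.
Proof.
move=> U Xv; rewrite -{1}(ext_pid U Xv) shift_ext // src_pid //.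
Qed.

Lemma shift_pcomp a b X : src a = rng b ->
  shift (pcomp a b) X = shift b (shift a X).
Proof.
move=> ab; apply/seteqP; split=> c; rewrite /shift /= src_pcomp //.
  by move=> [bc Xc]; rewrite rng_pcomp // pcompA.
by move=> [bc [_ Xc]]; rewrite -pcompA.
Qed.

Lemma ext_pcomp a b X : src a = rng b -> ext (pcomp a b) X = ext a (ext b X).
Proof.
move=> ab; apply/seteqP; split=> c.
  move=> [d [Xd]]; rewrite src_pcomp // => bd; rewrite -pcompA // => pc.
  exists (pcomp b d); split; rewrite ?rng_pcomp //.
  by exists d; split=> //; apply: prefix_refl.
move=> [d [[e [Xe be pd]] ad pc]]; exists e; rewrite src_pcomp //; split=> //.
rewrite -pcompA //; apply: prefix_trans pc _.
exact: prefix_pcomp2.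
Qed.

Lemma shift_ultra a X : ultra X -> X a -> ultra (shift a X).
Proof.
move=> U Xa; have [U1 U2 U3] := U; split.
- move=> b c [ac Xc] bc; have ab : src a = rng b by rewrite ac (prefix_rng bc).
  by split=> //; apply: U1 Xc _; apply: prefix_pcomp2.
- move=> b c [ab Xb] [ac Xc]; have [d Xd [[x bx dE] [y cy dE']]] := U2 _ _ Xb Xc.
  move: bx cy; rewrite !src_pcomp // => bx cy.
  rewrite -pcompA // in dE; rewrite -pcompA // in dE'.
  exists (pcomp b x); first by split; rewrite -?dE ?rng_pcomp.
  split; first by exists x.
  exists y => //; move: dE'; rewrite dE => /pcomp_injl; apply; by rewrite rng_pcomp.
- move=> n; have [b Xb [[x ax bE] nb]] := ultra_above n U Xa.
  by exists x; [split; rewrite -?bE|apply: (@le_paths_suffix _ _ _ a); rewrite -?bE].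
Qed.

Hypothesis hlc : locally_convex L.

Lemma ext_ultra a X : ultra X -> X (pid L (src a)) -> ultra (ext a X).
Proof.
move=> U Xa; have [U1 U2 U3] := U; split.
- by move=> b c [d [Xd ad cd]] bc; exists d; split=> //; apply: prefix_trans bc cd.
- move=> b c [d [Xd ad bd]] [e [Xe ae ce]]; have [f Xf [df ef]] := U2 _ _ Xd Xe.
  have af : src a = rng f by rewrite ad (prefix_rng df).
  exists (pcomp a f); first by exists f; split=> //; apply: prefix_refl.
  by split; [apply: prefix_trans bd _|apply: prefix_trans ce _]; apply: prefix_pcomp2.
- move=> n; have [b Xb nb] := U3 n.
  have ab : src a = rng b by rewrite (ultra_src U Xa Xb).
  (* [pcomp a b] lies in [le_paths (pdeg a + n)]; its truncation to [n] lies in [le_paths n] by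
     local convexity. *)
  have [c cab dc] := truncate (pcomp a b) n.
  exists c; first by exists b.
  apply: (le_paths_truncate hlc (n := pdeg a + n)) cab dc; last exact: dle_addl.
  by apply: le_paths_pcomp => //; apply: le_paths_deg.
Qed.

(** The term of the chain whose index is the coordinate sum of [n] is long enough in every
    direction, and its truncation to [n] is the required member of [le_paths n]. *)
Lemma chain_ultra (mu : nat -> path L) :
  (forall j, prefix (mu j) (mu j.+1)) ->
  (forall j, exists2 m, dle (dconst k j) m & le_paths m (mu j)) ->
  ultra [set a | exists j, prefix a (mu j)].
Proof.
move=> hmu hm.
have mono i j : (i <= j)%N -> prefix (mu i) (mu j).
  elim: j => [|j IH]; first by rewrite leqn0 => /eqP ->; apply: prefix_refl.
  rewrite leq_eqVlt ltnS => /orP[/eqP -> |/IH h]; first exact: prefix_refl.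
  exact: prefix_trans h (hmu j).
split.
- by move=> a b [j bj] ab; exists j; apply: prefix_trans ab bj.
- move=> a b [i ai] [j bj]; exists (mu (i + j)%N).
    by exists (i + j)%N; apply: prefix_refl.
  split; [apply: prefix_trans ai _|apply: prefix_trans bj _]; apply: mono.
    exact: leq_addr.
  exact: leq_addl.
- move=> n; have [m jm lm] := hm (\sum_i n i)%N.
  have [b bj db] := truncate (mu (\sum_i n i)%N) n.
  exists b; first by exists (\sum_i n i)%N.
  apply: le_paths_truncate lm _ bj db => //.
  apply/dleP => i; have := dleP _ _ jm i; rewrite ffunE; apply: leq_trans.
  by rewrite (bigD1 i) //= leq_addr.
Qed.

(** Stagewise construction of a boundary path from [v]: every stage keeps the invariant [Q], stage
    [j] also meets the requirement [step j], and the bound [dconst k 1] forces progress in every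
    direction that is not blocked at the end of the stage. *)
Lemma ultra_steps v (Q : path L -> Prop) (step : nat -> path L -> Prop) :
  Q (pid L v) ->
  (forall j a, rng a = v -> Q a -> exists b n, [/\ src a = rng b,
      dle (dconst k 1) n, le_paths n b, Q (pcomp a b) & step j (pcomp a b)]) ->
  exists X, [/\ ultra X, X (pid L v),
    forall a, X a -> exists2 b, X b & prefix a b /\ Q b
  & forall j, exists2 b, X b & step j b].
Proof.
move=> Qv next.
pose good j a := [/\ rng a = v, Q a &
  exists2 m, dle (dconst k j) m & le_paths m a].
(* Choice asks for a total function; pairs that are not [good] get an arbitrary value. *)
have /choice [f fP] : forall ja : nat * path L, exists c,
    good ja.1 ja.2 -> [/\ good ja.1.+1 c, prefix ja.2 c & step ja.1 c].
  move=> [j a] /=; have [[ra Qa [m jm lm]]|ng] := pselect (good j a); last by exists a.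
  have [b [n [ab n1 lb Qab st]]] := next j a ra Qa.
  exists (pcomp a b) => _; split=> //; last by exists b.
  split; rewrite ?rng_pcomp //; exists (m + n); last exact: le_paths_pcomp.
  apply/dleP => i; have := dleP _ _ jm i; have := dleP _ _ n1 i.
  by rewrite !degE; lia.
pose mu := fix mu j := if j is i.+1 then f (i, mu i) else pid L v.
have gmu j : good j (mu j).
  elim: j => [|j IH]; last by case: (fP (j, mu j) IH).
  split; rewrite ?rng_pid //; exists 0.
    by apply/dleP => i; rewrite !ffunE.
  by rewrite -(pdeg_pid (v : vertex L)); apply: le_paths_deg.
have pmu j : prefix (mu j) (mu j.+1) by case: (fP (j, mu j) (gmu j)).
exists [set a | exists j, prefix a (mu j)]; split.
- by apply: chain_ultra => // j; case: (gmu j).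
- by exists 0%N; apply: prefix_refl.
- move=> a [j aj]; exists (mu j); first by exists j; apply: prefix_refl.
  by split=> //; case: (gmu j).
- move=> j; exists (mu j.+1); first by exists j.+1; apply: prefix_refl.
  by case: (fP (j, mu j) (gmu j)).
Qed.

Lemma ultra_exists v : exists2 X, ultra X & X (pid L v).
Proof.
have [//|j a _ _|X [U Xv _ _]] :=
  @ultra_steps v (fun=> True) (fun _ _ => True); last by exists X.
have [b rb lb] := le_paths_exists (src a) (dconst k 1).
by exists b, (dconst k 1); split=> //; apply: dle_refl.
Qed.

Definition compatible a b := exists2 c, prefix a c & prefix b c.

Lemma compatible_sym a b : compatible a b -> compatible b a.
Proof. by case=> c; exists c. Qed.

(** Contrapositively, if [pcomp a c] and [pcomp b c] have a common extension for every [c] in [X],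
    then each of the two sets contains the other. *)
Lemma ext_separate a b X : ultra X -> X (pid L (src a)) -> src a = src b ->
  ext a X <> ext b X ->
  exists2 c, X c & ~ compatible (pcomp a c) (pcomp b c).
Proof.
move=> U Xa ab; apply: contraPP => h.
have {}h c : X c -> compatible (pcomp a c) (pcomp b c).
  by move=> Xc; apply: contrapT => nc; apply: h; exists c.
suff sub a' b' : X (pid L (src a')) -> src a' = src b' ->
    (forall c, X c -> compatible (pcomp a' c) (pcomp b' c)) -> ext a' X `<=` ext b' X.
  apply; apply/seteqP; split; apply: sub => //; first by rewrite -ab.
  by move=> c /h; apply: compatible_sym.
move=> {}Xa {}ab {}h d [c [Xc ac dc]].
(* Extend [c] so far that any direction in which [pcomp b' c'] is still shorter than [d] is blocked
   at [src c']; a common extension then cannot make up the difference. *)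
have [c' Xc' [cc' lc']] := ultra_above (pdeg d) U Xc.
have ac' : src a' = rng c' by rewrite (prefix_rng cc').
have bc' : src b' = rng c' by rewrite -ab.
have [e ae be] := h _ Xc'.
exists c'; split=> //; apply: (@prefix_total _ _ _ _ e) => //.
  by apply: prefix_trans ae; apply: prefix_trans dc _; apply: prefix_pcomp2.
apply/dleP => i; rewrite leqNgt; apply/negP => lt.
case: be => y by_ eE.
have [_ bl] := (le_pathsP _ _).1 lc'.
have dy : pdeg y i = 0%N.
  apply: (@blocked_deg _ _ (src c')); last by rewrite -by_ src_pcomp.
  by apply: bl; move: lt; rewrite pdeg_pcomp // !degD; lia.
have : prefix d e by apply: prefix_trans ae; apply: prefix_trans dc _; apply: prefix_pcomp2.
move=> /prefix_dle /dleP /(_ i); rewrite eE pdeg_pcomp // [(_ + pdeg y) i]degD dy.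
by lia.
Qed.

Definition ultra_aperiodic := forall v, exists X, [/\ ultra X, X (pid L v) &
  forall a b, src a = v -> src b = v -> a <> b -> ext a X <> ext b X].

(* Baire category: each pair [a <> b] is separated on a dense open set of
   boundary paths, and there are countably many pairs. *)
Lemma ultra_aperiodicP :
  (forall a b, src a = src b -> a <> b ->
    exists X, [/\ ultra X, X (pid L (src a)) & ext a X <> ext b X]) ->
  ultra_aperiodic.
Proof.
move=> sep v.
(* Requirement [j] concerns the pair with code [j]. It passes to all extensions of [c], and the
   hypothesis lets any path from [v] be extended until it holds. *)
pose step j c := forall a b, pickle (a, b) = j ->
  src a = v -> src b = v -> a <> b -> ~ compatible (pcomp a c) (pcomp b c).
have [//|j c rc _|X [U Xv _ st]] := @ultra_steps v (fun=> True) step.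
  have [[[a b] [jE ra rb ab]]|no] := pselect (exists ab : path L * path L,
    [/\ pickle ab = j, src ab.1 = v, src ab.2 = v & ab.1 <> ab.2]); last first.
    have [b rb lb] := le_paths_exists (src c) (dconst k 1).
    exists b, (dconst k 1); split=> //; first exact: dle_refl.
    by move=> a b' jE ra rb' ab; case: no; exists (a, b').
  rewrite /= in ra rb ab.
  have ac : src a = rng c by rewrite ra.
  have bc : src b = rng c by rewrite rb.
  (* The hypothesis is used at the prolonged pair, so that the separating boundary path starts where
     [c] ends. *)
  have [||X [U Xv sp]] := sep (pcomp a c) (pcomp b c).
  - by rewrite !src_pcomp.
  - by move=> /pcomp_injr e; apply: ab; apply: e.
  have [||d Xd nd] := ext_separate U _ _ sp; rewrite ?src_pcomp //.
    by rewrite src_pcomp in Xv.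
  have [e Xe [de le]] := ultra_above (dconst k 1) U Xd.
  have ce : src c = rng e.
    by rewrite src_pcomp in Xv => //; rewrite (ultra_src U Xv Xe).
  have cd : src c = rng d by rewrite ce (prefix_rng de).
  exists e, (pdeg d + dconst k 1); split=> //; first exact: dle_addl.
  move=> a' b' jE'; move: jE; rewrite -jE' => /(pcan_inj pickleK) [<- <-] _ _ _.
  move=> [f af bf]; apply: nd; exists f; rewrite -pcompA //.
    by apply: prefix_trans af; apply: prefix_pcomp2; rewrite ?rng_pcomp //;
      apply: prefix_pcomp2.
  by apply: prefix_trans bf; apply: prefix_pcomp2; rewrite ?rng_pcomp //;
    apply: prefix_pcomp2.
exists X; split=> // a b ra rb ab e.
have [c Xc stc] := st (pickle (a, b)).
have rc := ultra_src U Xv Xc.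
have Ua : ultra (ext a X) by apply: ext_ultra; rewrite ?ra.
have [_ U2 _] := Ua.
have [||d _ [d1 d2]] := U2 (pcomp a c) (pcomp b c).
- by apply/ext_pcompE => //; rewrite ra.
- by rewrite e; apply/ext_pcompE => //; rewrite rb.
by apply: (stc a b) => //; exists d.
Qed.

End Ultra.

(** * Degrees with infinite coordinates *)

Section ExtendedDegrees.
Variable k : nat.
Implicit Types (n p q : deg k) (m : edeg k).

Lemma dleeP p m : reflect (forall i c, m i = Some c -> (p i <= c)%N) (dlee p m).
Proof.
apply: (iffP forallP) => h i; have := h i; first by move=> + c mi; rewrite mi.
by case: (m i) => // c; apply.
Qed.

Lemma dlee_trans q p m : dle p q -> dlee q m -> dlee p m.
Proof.
move=> /dleP pq /dleeP qm; apply/dleeP => i c /qm; exact: leq_trans.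
Qed.

Lemma dlee_daddee n p m : dlee p (daddee n m) = dlee (dsub p n) m.
Proof.
apply/dleeP/dleeP => h i c mi; last first.
  move: mi; rewrite ffunE; case E: (m i) => [d|] //= -[<-].
  by have := h i d E; rewrite ffunE; lia.
by have := h i (n i + c)%N; rewrite !ffunE mi => /(_ erefl); lia.
Qed.

(** Degrees supported in a single coordinate already detect each entry of [m], finite or
    infinite. *)
Lemma edeg_ext m m' : (forall p, dlee p m = dlee p m') -> m = m'.
Proof.
move=> h; apply/ffunP => i.
pose e c : deg k := [ffun j => if j == i then c else 0%N].
have eE c M : dlee (e c) M = (if M i is Some d then (c <= d)%N else true).
  apply/dleeP/idP => [/(_ i)|H j d Mj]; rewrite ffunE ?eqxx.
    by case: (M i) => // d /(_ d erefl).
  by case: eqP => // ji; move: H; rewrite -ji Mj.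
have := fun c => etrans (esym (eE c m)) (etrans (h (e c)) (eE c m')).
case: (m i) (m' i) => [d|] [d'|] // H.
- by congr Some; have := H d; have := H d'; rewrite !leqnn; lia.
- by have := H d.+1; rewrite ltnn.
- by have := H d'.+1; rewrite ltnn.
Qed.

End ExtendedDegrees.

(** * The correspondence between boundary paths and [ultra] sets *)

Section BoundaryPaths.
Variables (k : nat) (L : kgraph k).
Implicit Types (a b c : path L) (u v w : vertex L) (m n p q : deg k).
Implicit Types (X Y : set (path L)) (x y : boundary_path L).

Definition bp_set x : set (path L) :=
  [set a | dlee (pdeg a) (bp_deg x) /\ a = bp_seg x 0 (pdeg a)].

Lemma bp_seg0_deg x p : dlee p (bp_deg x) -> pdeg (bp_seg x 0 p) = p.
Proof. by move=> h; rewrite -[RHS](bp_seg_deg (dle0 p) h) add0r. Qed.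

Lemma bp_set_seg x p : dlee p (bp_deg x) -> bp_set x (bp_seg x 0 p).
Proof. by move=> h; split; rewrite bp_seg0_deg. Qed.

Lemma bp_at_src x p : dlee p (bp_deg x) -> bp_at x p = src (bp_seg x 0 p).
Proof. by move=> h; rewrite /bp_at -(bp_seg_src (dle0 p) h). Qed.

Lemma bp_seg_split x p q : dle p q -> dlee q (bp_deg x) ->
  src (bp_seg x 0 p) = rng (bp_seg x p q) /\
  pcomp (bp_seg x 0 p) (bp_seg x p q) = bp_seg x 0 q.
Proof.
move=> pq qx; have px := dlee_trans pq qx.
by split; [rewrite (bp_seg_rng pq qx) -bp_at_src|apply: bp_seg_comp => //; apply: dle0].
Qed.

Lemma bp_seg_prefix x p q : dle p q -> dlee q (bp_deg x) ->
  prefix (bp_seg x 0 p) (bp_seg x 0 q).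
Proof. by move=> pq qx; have [e1 e2] := bp_seg_split pq qx; exists (bp_seg x p q). Qed.

Lemma bp_ultra x : ultra (bp_set x).
Proof.
split.
- move=> a b [bx bE] ab; have ax := dlee_trans (prefix_dle ab) bx.
  split=> //; apply: (prefix_eqdeg ab); last by rewrite bp_seg0_deg.
  by rewrite bE; apply: bp_seg_prefix => //; apply: prefix_dle.
- move=> a b [ax aE] [bx bE].
  pose p : deg k := [ffun i => maxn (pdeg a i) (pdeg b i)].
  have px : dlee p (bp_deg x).
    apply/dleeP => i c xi; rewrite ffunE geq_max.
    by rewrite (dleeP _ _ ax _ _ xi) (dleeP _ _ bx _ _ xi).
  exists (bp_seg x 0 p); first exact: bp_set_seg.
  by split; [rewrite aE|rewrite bE]; apply: bp_seg_prefix => //; apply/dleP => i;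
    rewrite ffunE ?leq_maxl ?leq_maxr.
(* [p] is [n] capped by the degree of [x]. Where the cap bites, the boundary condition blocks the
   direction. *)
- move=> n; pose p : deg k :=
    [ffun i => if bp_deg x i is Some c then minn c (n i) else n i].
  have px : dlee p (bp_deg x).
    by apply/dleeP => i c xi; rewrite ffunE xi geq_minl.
  exists (bp_seg x 0 p); first exact: bp_set_seg.
  apply/le_pathsP; rewrite bp_seg0_deg //; split.
    by apply/dleP => i; rewrite ffunE; case: (bp_deg x i) => // c; rewrite geq_minr.
  move=> i lt; apply/blockedP; rewrite -bp_at_src //.
  apply: bp_boundary => //; move: lt; rewrite ffunE.
  case: (bp_deg x i) => [c|]; last by rewrite ltnn.
  by move=> lt; congr Some; lia.
Qed.

Lemma bp_set_pid x : bp_set x (pid L (bp_rng x)).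
Proof.
have x0 : dlee 0 (bp_deg x) by apply/dleeP => i c _; rewrite deg0.
by rewrite /bp_rng /bp_at -bp_seg_id //; apply: bp_set_seg.
Qed.

Lemma bp_eq_set x y : bp_eq x y -> bp_set x `<=` bp_set y.
Proof.
by move=> [dxy sxy] a [ax aE]; split; rewrite -?dxy // -sxy // dle0.
Qed.

(** Sets satisfying [ultra] are maximal: the member of [X] in [le_paths (pdeg b)] also lies in [Y],
    hence has [b] as a prefix. *)
Lemma ultra_subset_eq X Y : ultra X -> ultra Y -> X `<=` Y -> X = Y.
Proof.
move=> [U1 _ U3] UY XY; apply/seteqP; split=> // b Yb.
have [c Xc lc] := U3 (pdeg b).
apply: (U1 _ _ Xc); apply: ultra_max UY (XY _ Xc) Yb lc _; exact: dle_refl.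
Qed.

Lemma ultra_sup X i : ultra X -> exists o : option nat,
  if o is Some d then (forall a, X a -> (pdeg a i <= d)%N) /\
                      exists2 a, X a & pdeg a i = d
  else forall d, exists2 a, X a & (d <= pdeg a i)%N.
Proof.
move=> U; have [[c hc]|nb] :=
  pselect (exists d, forall a, X a -> (pdeg a i <= d)%N); last first.
  exists None => c; apply: contrapT => h; apply: nb; exists c => a Xa.
  by rewrite leqNgt; apply/negP => lt; apply: h; exists a => //; apply: ltnW.
have ex : exists d, `[< forall a, X a -> (pdeg a i <= d)%N >].
  by exists c; apply/asboolP.
case: (ex_minnP ex) => d /asboolP hd dmin; exists (Some d); split=> //.
apply: contrapT => h; case: d hd dmin h => [|d] hd dmin h.
  have [_ _ /(_ 0) [a Xa _]] := U; apply: h; exists a => //.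
  by apply/eqP; rewrite -leqn0; apply: hd.
have /dmin : `[< forall a, X a -> (pdeg a i <= d)%N >]; last by rewrite ltnn.
apply/asboolP => a Xa; have := hd a Xa; rewrite leq_eqVlt => /orP[/eqP e|//].
by case: h; exists a.
Qed.

(** Here [c] is the segment x(p, q) of the boundary path x encoded by [X]. *)
Definition ultra_seg X p q c := exists a, [/\ X (pcomp a c), src a = rng c,
  pdeg a = p & pdeg (pcomp a c) = q].

Lemma ultra_seg_uniq X p q c c' : ultra X -> ultra_seg X p q c ->
  ultra_seg X p q c' -> c = c'.
Proof.
move=> U [a [Xc ac da dc]] [a' [Xc' ac' da' dc']].
have e : pcomp a c = pcomp a' c' by apply: ultra_uniq U _ _ _; rewrite ?dc.
by have [] := pcomp_inj ac ac' _ e; rewrite ?da.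
Qed.

Hypothesis hlc : locally_convex L.

(** The degree of the boundary path is the coordinatewise supremum of the degrees of the members of
    [X]. By [mP] these degrees are exactly the finite ones below it, and each segment is then
    determined. *)
Lemma ultra_bp X : ultra X -> exists x, bp_set x = X.
Proof.
move=> U; have [U1 U2 U3] := U.
have /choice [f fP] := fun i => ultra_sup i U.
pose m : edeg k := [ffun i => f i].
have mP p : dlee p m <-> exists2 a, X a & pdeg a = p.
  split=> [pm|[a Xa <-]]; last first.
    apply/dleeP => i c; rewrite ffunE => fi; have := fP i; rewrite fi => -[h _].
    exact: h.
  have [a Xa la] := U3 p; exists a => //; have [dap bl] := (le_pathsP _ _).1 la.
  apply: dle_anti => //; apply/dleP => i; rewrite leqNgt; apply/negP => lt.
  have [b Xb hb] : exists2 b, X b & (p i <= pdeg b i)%N.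
    have := fP i; case E: (f i) => [c|]; last exact.
    move=> [_ [b Xb bE]]; exists b; rewrite // bE.
    by apply: (dleeP _ _ pm); rewrite ffunE.
  have [c _ [[y ay ->] /prefix_dle/dleP/(_ i)]] := U2 _ _ Xa Xb.
  by rewrite pdeg_pcomp // degD (blocked_deg (bl i lt) (esym ay)); lia.
have [a0 Xa0 _] := U3 0.
have /choice [g gP] : forall pq : deg k * deg k, exists c,
    dle pq.1 pq.2 -> dlee pq.2 m -> ultra_seg X pq.1 pq.2 c.
  move=> [p q] /=; have [[pq /mP [b Xb db]]|h] := pselect (dle p q /\ dlee q m).
    rewrite -db in pq *; have [a [c [ac bE da]]] := path_split pq.
    by exists c => _ _; exists a; rewrite -bE.
  by exists a0 => h1 h2; case: h.
pose seg p q := g (p, q).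
have segP p q : dle p q -> dlee q m -> ultra_seg X p q (seg p q).
  exact: (gP (p, q)).
have segI a p : X a -> pdeg a = p -> seg p p = pid L (src a).
  move=> Xa da; apply: (@ultra_seg_uniq X p p) => //.
    by apply: segP; [exact: dle_refl|apply/mP; exists a].
  by exists a; rewrite pcompp1 rng_pid.
have obE a p : X a -> pdeg a = p -> bp_ob seg p = src a.
  by move=> Xa da; rewrite /bp_ob (segI a) // rng_pid.
have hdeg p q : dle p q -> dlee q m -> p + pdeg (seg p q) = q.
  by move=> pq qm; have [a [_ ac da]] := segP _ _ pq qm; rewrite pdeg_pcomp // da.
have hrng p q : dle p q -> dlee q m -> rng (seg p q) = bp_ob seg p.
  move=> pq qm; have [a [Xc ac da dc]] := segP _ _ pq qm.
  have Xa : X a by apply: U1 Xc _; apply: prefix_pcomp.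
  by rewrite (obE a).
have hsrc p q : dle p q -> dlee q m -> src (seg p q) = bp_ob seg q.
  move=> pq qm; have [a [Xc ac da dc]] := segP _ _ pq qm.
  by rewrite (obE _ _ Xc dc) src_pcomp.
have hid p : dlee p m -> seg p p = pid L (bp_ob seg p).
  by move=> /mP [a Xa da]; rewrite (segI a) // (obE a).
have hcomp p q t : dle p q -> dle q t -> dlee t m ->
    pcomp (seg p q) (seg q t) = seg p t.
  move=> pq qt tm; have qm := dlee_trans qt tm; have pt := dle_trans pq qt.
  apply: (@ultra_seg_uniq X p t) => //; last exact: segP.
  have e := hsrc _ _ pq qm; rewrite -(hrng _ _ qt tm) in e.
  have [a [Xc ac da dc]] := segP _ _ pq qm.
  have [a' [Xc' ac' da' dc']] := segP _ _ qt tm.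
  have aE : a' = pcomp a (seg p q).
    apply: (ultra_uniq U) => //; last by rewrite da'.
    by apply: U1 Xc' _; apply: prefix_pcomp.
  rewrite aE -pcompA // in Xc' dc'.
  by exists a; rewrite rng_pcomp.
have hbd p i : dlee p m -> m i = Some (p i) ->
    paths_from (bp_ob seg p) (ddelta i) = set0.
  move=> /mP [a Xa da]; rewrite ffunE => fi; rewrite (obE a) //; apply/blockedP.
  (* [b] extends [a] but gains nothing in direction [i], where [a] is already maximal. So [src b] is
     blocked, and the block moves back to [src a] along a piece of degree 0 in direction [i]. *)
  have [b Xb [[c ac bE] lb]] := ultra_above (ddelta i) U Xa.
  have := fP i; rewrite fi => -[/(_ _ Xb) hb _].
  have [_ /(_ i) bl] := (le_pathsP _ _).1 lb.
  have {}bl : blocked (src b) i by apply: bl; rewrite da !degE eqxx addn1 ltnS.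
  rewrite ac; apply: (blocked_back hlc); last by move: bl; rewrite bE src_pcomp.
  by move: hb; rewrite bE pdeg_pcomp // degD da; lia.
exists (BoundaryPath hdeg hrng hsrc hid hcomp hbd).
apply/seteqP; split=> a.
  move=> [/= am aE]; have [b [Xb ba db _]] := segP _ _ (dle0 _) am.
  move: Xb ba; rewrite -aE (pdeg0_pid db) src_pid => + ba.
  by rewrite ba pcomp1p.
move=> Xa; have am : dlee (pdeg a) m by apply/mP; exists a.
split=> //=; apply: (ultra_seg_uniq U _ (segP _ _ (dle0 _) am)).
by exists (pid L (rng a)); rewrite pcomp1p src_pid pdeg_pid.
Qed.

Lemma concat_ext a x y : src a = bp_rng x -> is_concat a x y ->
  bp_set y = ext a (bp_set x).
Proof.
move=> ax [dy ay sy]; apply/esym; apply: ultra_subset_eq.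
- by apply: (ext_ultra hlc (bp_ultra x)); rewrite ax; apply: bp_set_pid.
- exact: bp_ultra.
have [Uy _ _] := bp_ultra y.
move=> b [c [[cx cE] ac bac]]; apply: Uy bac.
have acy : dlee (pdeg a + pdeg c) (bp_deg y) by rewrite dy dlee_daddee daddK.
split; rewrite pdeg_pcomp //.
rewrite -(bp_seg_comp (dle0 _) (dle_addr _ _) acy) ay; congr pcomp.
by rewrite [LHS]cE -sy ?dle0 // addr0.
Qed.

Lemma ext_concat a x y : src a = bp_rng x -> bp_set y = ext a (bp_set x) ->
  is_concat a x y.
Proof.
move=> ax yE; have Ux := bp_ultra x; have Uy := bp_ultra y.
have xa : bp_set x (pid L (src a)) by rewrite ax; apply: bp_set_pid.
have acy c : bp_set x c -> bp_set y (pcomp a c).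
  by move=> xc; rewrite yE; apply/ext_pcompE => //; rewrite (ultra_src Ux xa xc).
have dE : bp_deg y = daddee (pdeg a) (bp_deg x).
  apply: edeg_ext => p; rewrite dlee_daddee; apply/idP/idP => [py|px].
    have := bp_set_seg py; rewrite yE => -[c [[cx _] ac /prefix_dle]].
    rewrite bp_seg0_deg // pdeg_pcomp // => /dleP h; apply: dlee_trans cx.
    by apply/dleP => i; have := h i; rewrite !degE; lia.
  have [] := acy _ (bp_set_seg px).
  rewrite pdeg_pcomp ?bp_seg0_deg // => [h _|]; first apply: dlee_trans h.
    by apply/dleP => i; rewrite !degE; lia.
  by rewrite (ultra_src Ux xa (bp_set_seg px)).
split=> //.
  have : bp_set y a by rewrite yE; apply: ext_self.
  by move=> [_ <-].
move=> p q pq qx; have px := dlee_trans pq qx.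
have [e1 e2] := bp_seg_split pq qx.
have acp t : dlee t (bp_deg x) -> src a = rng (bp_seg x 0 t) /\
    bp_seg y 0 (pdeg a + t) = pcomp a (bp_seg x 0 t).
  move=> tx; have at_ : src a = rng (bp_seg x 0 t).
    by rewrite (ultra_src Ux xa (bp_set_seg tx)).
  split=> //; have [_] := acy _ (bp_set_seg tx).
  by rewrite pdeg_pcomp // bp_seg0_deg.
have [a1 a2] := acp _ px; have [a3 a4] := acp _ qx.
have pq' : dle (pdeg a + p) (pdeg a + q) by rewrite dle_add2.
have qy : dlee (pdeg a + q) (bp_deg y) by rewrite dE dlee_daddee daddK.
have [] := bp_seg_split pq' qy; rewrite a2 a4 -e2 pcompA // => e3.
by apply: pcomp_injl => //; rewrite src_pcomp.
Qed.

Lemma aperiodicP : aperiodic L <-> ultra_aperiodic L.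
Proof.
split=> ap v.
  have [x xv xP] := ap v; exists (bp_set x); split=> //.
  - exact: bp_ultra.
  - by rewrite -xv; apply: bp_set_pid.
  move=> a b av bv ab e.
  have [y yE] : exists y, bp_set y = ext a (bp_set x).
    apply: ultra_bp; apply: (ext_ultra hlc (bp_ultra x)).
    by rewrite av -xv; apply: bp_set_pid.
  apply: (xP a b av bv ab y y) => //; apply: ext_concat; rewrite ?av ?bv //.
  by rewrite -e.
have [X [U Xv XP]] := ap v; have [x xE] := ultra_bp U.
have xv : bp_rng x = v.
  have := @ultra_src _ _ _ _ (pid L (bp_rng x)) U Xv; rewrite rng_pid; apply.
  by rewrite -xE; apply: bp_set_pid.
exists x => // a b av bv ab ax bx /concat_ext axE /concat_ext bxE abE.
apply: (XP a b av bv ab); rewrite -xE -axE ?av // -bxE ?bv //.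
by apply: ultra_subset_eq (bp_ultra _) (bp_ultra _) _; apply: bp_eq_set.
Qed.

Lemma cofinalP : cofinal L <-> forall X v, ultra X ->
  exists2 c, X c & exists2 a, rng a = v & src a = src c.
Proof.
split=> [cf X v /ultra_bp [x <-]|cf x v].
  have [n nx [a [rv sa]]] := cf x v.
  by exists (bp_seg x 0 n); [apply: bp_set_seg|exists a; rewrite // sa bp_at_src].
have [c [cx cE] [a rv sa]] := cf _ v (bp_ultra x).
by exists (pdeg c) => //; exists a; rewrite bp_at_src // -cE.
Qed.

End BoundaryPaths.

(** * Algebras without unit *)

Section FiniteSums.

Lemma fsbig_morph (I : choiceType) (A B : nmodType) (g : A -> B) (D : set I)
    (f : I -> A) : finite_set D -> g 0 = 0 -> {morph g : x y / x + y} ->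
  g (\sum_(i \in D) f i) = \sum_(i \in D) g (f i).
Proof.
by move=> fD g0 gD; rewrite !fsbig_finite //; apply: big_morph.
Qed.

Lemma fsbig_pick (I : choiceType) (A : nmodType) (D : set I) (f : I -> A) i :
  D i -> (forall j, D j -> j <> i -> f j = 0) -> \sum_(j \in D) f j = f i.
Proof.
move=> Di f0; rewrite -[RHS](fsbig_set1 +%R i f); apply/esym; apply: fsbig_widen => [j -> //|].
by move=> j [Dj ji]; apply: f0.
Qed.

End FiniteSums.

Section NUAlgebraTheory.
Variables (R : comNzRingType) (A : nuAlgType R).
Implicit Types x y z : A.

Lemma numul0r x : 0 ** x = 0.
Proof. by apply: (addrI (0 ** x)); rewrite -numulDl !addr0. Qed.

Lemma numulr0 x : x ** 0 = 0.
Proof. by apply: (addrI (x ** 0)); rewrite -numulDr !addr0. Qed.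

Lemma numul_suml (I : Type) (r : seq I) (P : pred I) (f : I -> A) x :
  (\sum_(i <- r | P i) f i) ** x = \sum_(i <- r | P i) f i ** x.
Proof.
by apply: (big_morph (fun z => z ** x)) => [y z|]; rewrite ?numulDl ?numul0r.
Qed.

Lemma numul_sumr (I : Type) (r : seq I) (P : pred I) (f : I -> A) x :
  x ** (\sum_(i <- r | P i) f i) = \sum_(i <- r | P i) x ** f i.
Proof.
by apply: (big_morph (fun z => x ** z)) => [y z|]; rewrite ?numulDr ?numulr0.
Qed.

Lemma numul_fsuml (I : choiceType) (D : set I) (f : I -> A) x : finite_set D ->
  (\sum_(i \in D) f i) ** x = \sum_(i \in D) f i ** x.
Proof.
move=> fD; apply: (fsbig_morph (g := fun z => z ** x)) => // [|y z].
  exact: numul0r.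
exact: numulDl.
Qed.

Lemma numul_fsumr (I : choiceType) (D : set I) (f : I -> A) x : finite_set D ->
  x ** (\sum_(i \in D) f i) = \sum_(i \in D) x ** f i.
Proof.
move=> fD; apply: (fsbig_morph (g := fun z => x ** z)) => // [|y z].
  exact: numulr0.
exact: numulDr.
Qed.

Definition subalg_closed (D : set A) :=
  [/\ D 0, forall (c : R) x y, D x -> D y -> D (c *: x + y)
    & forall x y, D x -> D y -> D (x ** y)].

(** The subalgebra generated by [G], as an intersection. Universality will show that a universal
    family generates its whole algebra. *)
Definition generated (G : set A) : {pred A} :=
  fun x => `[< forall D, subalg_closed D -> G `<=` D -> D x >].

Lemma generated_submod G : GRing.submod_closed (generated G).
Proof.
split=> [|c x y /asboolP hx /asboolP hy]; apply/asboolP => D cD GD.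
  by case: cD.
by case: (cD) => _ cl _; apply: cl; [apply: hx|apply: hy].
Qed.

HB.instance Definition _ G :=
  GRing.isSubmodClosed.Build R A (generated G) (generated_submod G).

Definition gen_alg G := {x : A | generated G x}.

HB.instance Definition _ G := Choice.on (gen_alg G).
HB.instance Definition _ G := [isSub of gen_alg G for @sval A (generated G)].
HB.instance Definition _ G := [SubChoice_isSubLmodule of gen_alg G by <:].

Lemma generated_mul G x y : x \in generated G -> y \in generated G ->
  x ** y \in generated G.
Proof.
move=> /asboolP hx /asboolP hy; apply/asboolP => D cD GD.
by case: (cD) => _ _; apply; [apply: hx|apply: hy].
Qed.

Lemma generated_sub G x : G x -> x \in generated G.
Proof. by move=> Gx; apply/asboolP => D _; apply. Qed.

Definition gen_mul G (x y : gen_alg G) : gen_alg G :=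
  exist (fun z => is_true (generated G z)) _ (generated_mul (valP x) (valP y)).

Lemma gen_mulA G : associative (@gen_mul G).
Proof. by move=> x y z; apply: val_inj; rewrite /= numulA. Qed.

Lemma gen_mulDl G : left_distributive (@gen_mul G) +%R.
Proof. by move=> x y z; apply: val_inj; rewrite /= numulDl. Qed.

Lemma gen_mulDr G : right_distributive (@gen_mul G) +%R.
Proof. by move=> x y z; apply: val_inj; rewrite /= numulDr. Qed.

Lemma gen_scaleAl G (c : R) (x y : gen_alg G) :
  c *: gen_mul x y = gen_mul (c *: x) y.
Proof. by apply: val_inj; rewrite /= nuscaleAl. Qed.

Lemma gen_scaleAr G (c : R) (x y : gen_alg G) :
  c *: gen_mul x y = gen_mul x (c *: y).
Proof. by apply: val_inj; rewrite /= nuscaleAr. Qed.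

HB.instance Definition _ G := Lmodule_isNUAlgebra.Build R (gen_alg G)
  (@gen_mulA G) (@gen_mulDl G) (@gen_mulDr G) (@gen_scaleAl G) (@gen_scaleAr G).

End NUAlgebraTheory.

(** * The algebra of endomorphisms of a module *)

Section Endomorphisms.
Variables (R : comNzRingType) (U : lmodType R).

Definition is_linear : {pred U -> U} := fun f => `[< linear f >].

Lemma is_linear_submod : GRing.submod_closed is_linear.
Proof.
split=> [|c f g /asboolP lf /asboolP lg]; apply/asboolP => d x y.
  by rewrite /= scaler0 addr0.
have E z : (c *: f + g) z = c *: f z + g z by [].
by rewrite !E lf lg !scalerDr !scalerA addrACA (mulrC c d).
Qed.

HB.instance Definition _ :=
  GRing.isSubmodClosed.Build R (U -> U) is_linear is_linear_submod.

Definition endo := {f : U -> U | is_linear f}.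

HB.instance Definition _ := Choice.on endo.
HB.instance Definition _ := [isSub of endo for @sval (U -> U) is_linear].
HB.instance Definition _ := [SubChoice_isSubLmodule of endo by <:].

Implicit Types f g h : endo.

Lemma endoP f : linear (val f).
Proof. exact/asboolP/(valP f). Qed.

Lemma comp_linear f g : is_linear (val f \o val g).
Proof. by apply/asboolP => c x y; rewrite /= endoP endoP. Qed.

Definition endo_mul f g : endo :=
  exist (fun z => is_true (is_linear z)) _ (comp_linear f g).

Lemma endo_mulA : associative endo_mul.
Proof. by move=> f g h; apply: val_inj. Qed.

Lemma endo_mulDl : left_distributive endo_mul +%R.
Proof. by move=> f g h; apply: val_inj. Qed.

Lemma endo_mulDr : right_distributive endo_mul +%R.
Proof.
move=> f g h; apply: val_inj; apply: funext => x.
by have := endoP f 1 (val g x) (val h x); rewrite !scale1r.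
Qed.

Lemma endo_scaleAl (c : R) f g : c *: endo_mul f g = endo_mul (c *: f) g.
Proof. by apply: val_inj. Qed.

Lemma endo_scaleAr (c : R) f g : c *: endo_mul f g = endo_mul f (c *: g).
Proof.
apply: val_inj; apply: funext => x.
have f0 : val f 0 = 0.
  by have := endoP f (-1) 0 0; rewrite scaler0 addr0 scaleN1r addNr.
by have := endoP f c (val g x) 0; rewrite f0 !addr0.
Qed.

Lemma endo_scaleE (c : R) f x : val (c *: f) x = c *: val f x.
Proof. by []. Qed.

HB.instance Definition _ := Lmodule_isNUAlgebra.Build R endo
  endo_mulA endo_mulDl endo_mulDr endo_scaleAl endo_scaleAr.

Lemma endo_numulE f g x : val (f ** g) x = val f (val g x).
Proof. by []. Qed.

End Endomorphisms.

Lemma fct_scaleE (R : comNzRingType) (T : Type) (c : R) (f : T -> R^o) t :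
  (c *: f) t = c * f t.
Proof. by []. Qed.

(** * Representations on boundary paths *)

Section CompositionOperators.
Variables (R : comNzRingType) (T : Type).
Implicit Types (D : set T) (g : T -> T) (f : T -> R^o).

(** A weighted composition operator, with the indicator function of [D] as its weight. *)
Definition op_fun D g f : T -> R^o := fun t => if `[< D t >] then f (g t) else 0.

Lemma op_linear D g : is_linear (op_fun D g).
Proof.
apply/asboolP => c f1 f2; apply: funext => t.
rewrite /op_fun [RHS](_ : _ = c *: (if `[< D t >] then f1 (g t) else 0 : R^o) +
  (if `[< D t >] then f2 (g t) else 0)) //.
by case: ifP => // _; rewrite scaler0 addr0.
Qed.

Definition op D g : endo (T -> R^o) :=
  exist (fun z => is_true (is_linear z)) _ (op_linear D g).

Lemma opE D g f t : val (op D g) f t = if `[< D t >] then f (g t) else 0.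
Proof. by []. Qed.

Lemma eq_op D D' g g' : (forall t, D t <-> D' t) -> (forall t, D t -> g t = g' t) ->
  op D g = op D' g'.
Proof.
move=> hD hg; apply: val_inj; apply: funext => f; apply: funext => t.
rewrite !opE; case: asboolP => Dt; case: asboolP => D't //; first by rewrite hg.
  by case: D't; apply/hD.
by case: Dt; apply/hD.
Qed.

Lemma op_mul D D' g g' :
  op D g ** op D' g' = op [set t | D t /\ D' (g t)] (g' \o g).
Proof.
apply: val_inj; apply: funext => f; apply: funext => t; rewrite opE.
rewrite endo_numulE !opE.
by rewrite asbool_and; case: asboolP => //= _.
Qed.

Lemma op0 D g : (forall t, ~ D t) -> op D g = 0.
Proof.
move=> hD; apply: val_inj; apply: funext => f; apply: funext => t; rewrite opE.
by case: asboolP => // /hD.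
Qed.

(** Applied to the constant function 1, the operator recovers [c] on [D]. This is what makes the
    kernels of the representations basic. *)
Lemma scale_op_eq0 (c : R) D g : c *: op D g = 0 -> c = 0 \/ forall t, ~ D t.
Proof.
move=> e; have [D0|/existsNP [t /contrapT Dt]] := pselect (forall t, ~ D t); first by right.
left; have := congr1 (fun h : endo _ => val h (fun=> 1) t) e.
by rewrite endo_scaleE fct_scaleE opE; case: asboolP => // _; rewrite mulr1.
Qed.

End CompositionOperators.

Section RowFinite.
Variables (k : nat) (L : kgraph k).

Lemma finite_dle (n : deg k) : finite_set [set m | dle m n].
Proof.
pose N := (\sum_i n i)%N.
pose h (q : {ffun 'I_k -> 'I_N.+1}) : deg k := [ffun i => nat_of_ord (q i)].
apply: (@sub_finite_set _ _ (h @` setT)); last first.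
  by apply: finite_image; apply: finite_finset.
move=> m /dleP mn; exists [ffun i => inord (m i)] => //.
apply: degP => i; rewrite !ffunE inordK // ltnS; apply: leq_trans (mn i) _.
by rewrite /N (bigD1 i) //= leq_addr.
Qed.

Lemma finite_le_paths : row_finite L ->
  forall v n, finite_set (le_paths_from (L := L) v n).
Proof.
move=> hrf v n.
apply: (@sub_finite_set _ _ (\bigcup_(m in [set m | dle m n]) paths_from v m)).
  by move=> a [ra [dn _]]; exists (pdeg a).
by apply: bigcup_finite => [|m _]; [apply: finite_dle|apply: hrf].
Qed.

End RowFinite.

(** * The representation on an invariant set of boundary paths *)

Section Representation.
Variables (k : nat) (L : kgraph k) (R : comNzRingType).
Hypothesis hrf : row_finite L.

Definition invariant (Y : set (set (path L))) :=
  [/\ forall X, Y X -> ultra X,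
      forall X a, Y X -> X (pid L (src a)) -> Y (ext a X)
    & forall X a, Y X -> X a -> Y (shift a X)].

(** Additive integer weights on paths. The second coordinate of a point of [T] keeps track of them,
    so that a suitable [c] separates paths that act alike on boundary paths. *)
Definition cocycle (c : path L -> int) :=
  forall a b, src a = rng b -> c (pcomp a b) = c a + c b.

Variables (Y : set (set (path L))) (c : path L -> int).
Hypotheses (hY : invariant Y) (hc : cocycle c).

Let T := (set (path L) * int)%type.

(** The operators act by pullback, so [repS a] reads a function at the shifted point: it takes the
    indicator of (x, n) to that of (a x, n + c(a)) when a x is defined, and [repT a] goes back. *)
Definition repP v : endo (T -> R^o) := op R [set t : T | Y t.1 /\ t.1 (pid L v)] id.
Definition repS a : endo (T -> R^o) := op R [set t : T | Y t.1 /\ t.1 a]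
  (fun t => (shift a t.1, t.2 - c a)).
Definition repT a : endo (T -> R^o) := op R [set t : T | Y t.1 /\ t.1 (pid L (src a))]
  (fun t => (ext a t.1, t.2 + c a)).

Lemma cocycle_pid v : c (pid L v) = 0.
Proof.
apply: (addrI (c (pid L v))); rewrite addr0 -hc ?src_pid ?rng_pid //.
by congr c; have := pcompp1 (pid L v); rewrite src_pid.
Qed.

Lemma repS_pid v : repS (pid L v) = repP v.
Proof.
have [Yu _ _] := hY; apply: eq_op => // -[X n] [/= YX Xv].
by rewrite shift_pid ?cocycle_pid ?subr0 //; apply: Yu.
Qed.

Lemma repT_pid v : repT (pid L v) = repP v.
Proof.
have [Yu _ _] := hY; apply: eq_op => [t|]; rewrite /= src_pid // => -[X n] [/= YX Xv].
by rewrite ext_pid ?cocycle_pid ?addr0 //; apply: Yu.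
Qed.

Lemma rep1 v w : repP v ** repP w = if v == w then repP v else 0.
Proof.
have [Yu _ _] := hY; rewrite op_mul; case: eqP => [->|vw].
  by apply: eq_op => // t; split=> [[]|[]].
apply: op0 => -[X n] [/= [YX Xv] [_ Xw]]; apply: vw.
by have := ultra_src (Yu _ YX) Xv Xw; rewrite rng_pid.
Qed.

Lemma rep2S a b : src a = rng b -> repS a ** repS b = repS (pcomp a b).
Proof.
have [Yu _ Ys] := hY; move=> ab; rewrite op_mul; apply: eq_op => -[X n] /=.
  split=> [[[YX Xa] [Ya [_ Xb]]] //|[YX Xab]].
  have Xa : X a by have [U _ _] := Yu _ YX; apply: U Xab _; apply: prefix_pcomp.
  by split=> //; split=> //; apply: Ys.
by move=> _; rewrite shift_pcomp // hc // opprD addrA.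
Qed.

Lemma rep2T a b : src a = rng b -> repT b ** repT a = repT (pcomp a b).
Proof.
have [Yu Ye _] := hY; move=> ab; rewrite op_mul; apply: eq_op => -[X n] /=.
  rewrite src_pcomp //; split=> [[] //|[YX Xb]]; split=> //; split; first exact: Ye.
  have [U _ _] := Yu _ (Ye _ _ YX Xb); apply: U (ext_self (Yu _ YX) Xb) _.
  by rewrite ab; apply: prefix_pid.
by move=> _; rewrite ext_pcomp // hc // addrA addrAC.
Qed.

Lemma rep2PS a : repP (rng a) ** repS a = repS a.
Proof.
have [Yu _ _] := hY; rewrite op_mul; apply: eq_op => // -[X n] /=.
split=> [[] //|[YX Xa]]; split=> //; split=> //.
exact: ultra_pid (Yu _ YX) Xa.
Qed.

Lemma rep2SP a : repS a ** repP (src a) = repS a.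
Proof.
have [Yu _ Ys] := hY; rewrite op_mul; apply: eq_op => // -[X n] /=.
split=> [[] //|[YX Xa]]; split=> //; split; first exact: Ys.
by split; rewrite ?rng_pid // pcompp1.
Qed.

Lemma rep2PT a : repP (src a) ** repT a = repT a.
Proof. by rewrite op_mul; apply: eq_op => // -[X n] /=; split=> [[]|[]]. Qed.

Lemma rep2TP a : repT a ** repP (rng a) = repT a.
Proof.
have [Yu Ye _] := hY; rewrite op_mul; apply: eq_op => // -[X n] /=.
split=> [[] //|[YX Xa]]; split=> //; split; first exact: Ye.
exact: ultra_pid (Yu _ (Ye _ _ YX Xa)) (ext_self (Yu _ YX) Xa).
Qed.

(** Two paths of [le_paths n] that are initial segments of one boundary path are equal, so for
    [a <> b] the product has empty domain. *)
Lemma rep3 n : n != 0 -> forall a b, le_paths n a -> le_paths n b ->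
  repT a ** repS b = if a == b then repP (src a) else 0.
Proof.
have [Yu Ye _] := hY; move=> _ a b la lb; rewrite op_mul; case: eqP => [<-|ab].
  apply: eq_op => -[X m] /=.
    split=> [[] //|[YX Xa]]; split=> //; split; first exact: Ye.
    exact: ext_self (Yu _ YX) Xa.
  by move=> [[YX Xa] _]; rewrite shift_ext ?addrK //; apply: Yu.
apply: op0 => -[X m] /= [[YX Xa] [Ya Xb]]; apply: ab.
exact: ultra_le_uniq (Yu _ Ya) (ext_self (Yu _ YX) Xa) Xb la lb.
Qed.

(** A boundary path from [v] has exactly one initial segment in [le_paths n], so at each point only
    one term of the sum survives. *)
Lemma rep4 v n : n != 0 ->
  repP v = \sum_(a \in le_paths_from v n) (repS a ** repT a).
Proof.
have [Yu Ye Ys] := hY; move=> _; apply: val_inj; apply: funext => f; apply: funext => t.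
pose F a : R^o := val (repS a ** repT a) f t.
have ST a : F a = if `[< Y t.1 /\ t.1 a >] then f t else 0.
  rewrite /F op_mul opE; case: t {F} => X m.
  case: asboolP => [/= [[YX Xa] _]|h]; case: asboolP => h' //.
  - by rewrite /= ext_shift ?subrK //; apply: Yu.
  - by case: h'.
  - case: h; case: h' => YX Xa; split=> //=; split; first exact: Ys.
    by split; rewrite ?rng_pid // pcompp1.
transitivity (\sum_(a \in le_paths_from v n) F a); last first.
  apply/esym; apply: (@fsbig_morph _ _ _ (fun e : endo (T -> R^o) => val e f t)) => //.
  exact: finite_le_paths.
move: {F} (F) ST => F ST; case: t ST => X m ST; rewrite opE.
case: asboolP => [[/= YX Xv]|h]; last first.
  rewrite fsbig1 // => a [ra _]; rewrite ST; case: asboolP => // -[YX Xa]; case: h.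
  by split=> //=; rewrite -ra; apply: ultra_pid (Yu _ YX) Xa.
have U := Yu _ YX; have [_ _ /(_ n) [a Xa la]] := U.
have ra := ultra_src U Xv Xa.
rewrite (fsbig_pick (i := a)) //; first by rewrite ST; case: asboolP => // -[].
move=> b [_ lb] ba; rewrite ST; case: asboolP => // -[_ Xb]; case: ba.
exact: ultra_le_uniq U Xb Xa lb la.
Qed.

Definition rep_family : KP_family L (endo (T -> R^o)) :=
  KPFamily repS_pid repT_pid rep1 rep2S rep2T rep2PS rep2SP rep2PT rep2TP rep3 rep4.

End Representation.

(** * Normal forms in the Kumjian-Pask algebra *)

Section LinearCombinations.
Variables (R : comNzRingType) (A : lmodType R) (I : choiceType) (F : I -> A).

Lemma collect_sum (r : seq (R * I)) :
  exists C : I -> R, \sum_(u <- r) u.1 *: F u.2 =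
    \sum_(i <- undup [seq u.2 | u <- r]) C i *: F i.
Proof.
exists (fun i => \sum_(u <- r | u.2 == i) u.1).
under [RHS]eq_bigr => i _ do rewrite scaler_suml.
rewrite (exchange_big_dep xpredT) //=; apply: eq_big_seq => u ur.
have us : u.2 \in undup [seq u.2 | u <- r] by rewrite mem_undup map_f.
rewrite big_mkcond (bigD1_seq u.2) ?undup_uniq //= eqxx.
by rewrite big1 ?addr0 // => i iu; rewrite eq_sym (negbTE iu).
Qed.

End LinearCombinations.

Section KPAlgebra.
Variables (k : nat) (L : kgraph k) (R : comNzRingType).
Hypotheses (hk : (0 < k)%N) (hlc : locally_convex L) (hrf : row_finite L).
Variables (KP : nuAlgType R) (ps : KP_family L KP).
Implicit Types (a b c d : path L) (v w : vertex L) (m n : deg k).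

Local Notation P := (kpP ps).
Local Notation S := (kpS ps).
Local Notation T := (kpT ps).

(** (KP3') and (KP4') demand a nonzero degree; adding (1,...,1) ensures that because [k] is
    positive. *)
Lemma dconst1_neq0 n : n + dconst k 1 != 0.
Proof.
apply/eqP => /ffunP /(_ (Ordinal hk)); rewrite !degE => /eqP.
by rewrite addn1.
Qed.

Lemma kpTS_self a : T a ** S a = P (src a).
Proof.
have [a0|an0] := eqVneq (pdeg a) 0.
  by rewrite (pdeg0_pid a0) src_pid kpT_pid kpS_pid kp1 eqxx.
by rewrite (kp3 ps an0) ?eqxx //; apply: le_paths_deg.
Qed.

Lemma kpPS0 v a : v <> rng a -> P v ** S a = 0.
Proof. by move=> va; rewrite -kp2PS numulA kp1; case: eqP; rewrite ?numul0r. Qed.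

Lemma kpTS_prefix a b : src a = rng b -> T a ** S (pcomp a b) = S b.
Proof. by move=> ab; rewrite -kp2S // numulA kpTS_self ab kp2PS. Qed.

Lemma kpTS_suffix a b : src a = rng b -> T (pcomp a b) ** S a = T b.
Proof. by move=> ab; rewrite -kp2T // -numulA kpTS_self ab kp2TP. Qed.

Lemma kpTS_neq a b : pdeg a = pdeg b -> a <> b -> T a ** S b = 0.
Proof.
move=> dab ab; have [a0|an0] := eqVneq (pdeg a) 0.
  have aE := pdeg0_pid a0; have b0 := a0; rewrite dab in b0.
  rewrite aE kpT_pid kpPS0 // => e; apply: ab.
  by rewrite aE e -pdeg0_pid.
rewrite (kp3 ps an0); first by case: eqP.
  exact: le_paths_deg.
by rewrite dab; apply: le_paths_deg.
Qed.

(* The truncation of a path of [Lambda^{<= n}] to [m <= n] lies in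
   [Lambda^{<= m}], where (KP3') applies. *)
Lemma kp_not_prefix n a b : le_paths n b -> dle (pdeg a) n -> ~ prefix a b ->
  T a ** S b = 0 /\ T b ** S a = 0.
Proof.
move=> lb an nab.
have [b1 b1b db1] := truncate b (pdeg a).
have lb1 := le_paths_truncate hlc lb an b1b db1.
have la := le_paths_deg a.
have ab1 : a <> b1 by move=> e; apply: nab; rewrite e.
suff [h1 h2] : T a ** S b1 = 0 /\ T b1 ** S a = 0.
  case: b1b => x b1x ->; split.
    by rewrite -kp2S // numulA h1 numul0r.
  by rewrite -kp2T // -numulA h2 numulr0.
have [a0|an0] := eqVneq (pdeg a) 0.
  have d0 : pdeg b1 = pdeg a by rewrite db1 a0; apply: degP => i; rewrite !degE minn0.
  by split; apply: kpTS_neq => //; apply: nesym.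
rewrite (kp3 ps an0) // (kp3 ps an0) //.
by split; case: eqP => // e; case: ab1.
Qed.

(** (KP4') inserted at [rng a]. Once [n] is above both degrees, [kp_not_prefix] kills all terms
    except those where [a] and [b] are both prefixes of [c]. *)
Lemma kpTS_expand a b n : n != 0 ->
  T a ** S b = \sum_(c \in le_paths_from (rng a) n) ((T a ** S c) ** (T c ** S b)).
Proof.
move=> n0; have fin := finite_le_paths hrf (rng a) n.
rewrite -{1}kp2TP (kp4 ps (rng a) n0) numul_fsumr // numul_fsuml //.
apply: eq_fsbigr => c /set_mem [rc _].
by rewrite -!numulA.
Qed.

Lemma kpTS_incompatible a b : ~ compatible a b -> T a ** S b = 0.
Proof.
move=> nab; rewrite (kpTS_expand _ _ (dconst1_neq0 (pdeg a + pdeg b))).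
apply: fsbig1 => c [rc lc].
have an : dle (pdeg a) (pdeg a + pdeg b + dconst k 1).
  by rewrite -addrA; apply: dle_addr.
have bn : dle (pdeg b) (pdeg a + pdeg b + dconst k 1).
  exact: dle_trans (dle_addl _ _) (dle_addr _ _).
have [ac|nac] := pselect (prefix a c); last first.
  by have [-> _] := kp_not_prefix lc an nac; rewrite numul0r.
have [bc|nbc] := pselect (prefix b c); first by case: nab; exists c.
by have [_ ->] := kp_not_prefix lc bn nbc; rewrite numulr0.
Qed.

(** * Spanning by the elements s_a t_b *)

Definition comb (r : seq (R * (path L * path L))) : KP :=
  \sum_(u <- r) u.1 *: (S u.2.1 ** T u.2.2).

Definition spans (Q : path L -> path L -> Prop) : set KP :=
  [set x | exists2 r, x = comb r & forall u, u \in r -> Q u.2.1 u.2.2].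

Lemma spans0 Q : spans Q 0.
Proof. by exists [::] => //; rewrite /comb big_nil. Qed.

Lemma spansD Q x y : spans Q x -> spans Q y -> spans Q (x + y).
Proof.
move=> [r -> hr] [s -> hs]; exists (r ++ s); first by rewrite /comb big_cat.
by move=> u; rewrite mem_cat => /orP[/hr|/hs].
Qed.

Lemma spansZ Q (t : R) x : spans Q x -> spans Q (t *: x).
Proof.
move=> [r -> hr]; exists [seq (t * u.1, u.2) | u <- r].
  rewrite /comb big_map scaler_sumr; apply: eq_bigr => u _; by rewrite /= scalerA.
by move=> u /mapP [u' /hr h ->].
Qed.

Lemma spans1 Q a b : Q a b -> spans Q (S a ** T b).
Proof.
move=> h; exists [:: (1, (a, b))]; first by rewrite /comb big_seq1 scale1r.
by move=> u; rewrite inE => /eqP ->.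
Qed.

Lemma spans_sum Q (I : eqType) (r : seq I) (f : I -> KP) :
  (forall i, i \in r -> spans Q (f i)) -> spans Q (\sum_(i <- r) f i).
Proof.
move=> h; rewrite big_seq; apply: big_ind => //; first exact: spans0.
exact: spansD.
Qed.

Lemma spans_fsum Q (I : choiceType) (D : set I) (f : I -> KP) : finite_set D ->
  (forall i, D i -> spans Q (f i)) -> spans Q (\sum_(i \in D) f i).
Proof.
move=> fD h; rewrite fsbig_finite //; apply: spans_sum => i.
by rewrite in_fset_set // => /set_mem /h.
Qed.

Definition same_src a b := src a = src b.

(** When [T b ** S c] is expanded over long paths [e], only terms with [e = pcomp b x = pcomp c y]
    survive, and each contributes [S (pcomp a x) ** T (pcomp d y)]. *)
Lemma spans_mul1 a b c d : src a = src b -> src c = src d ->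
  spans same_src ((S a ** T b) ** (S c ** T d)).
Proof.
move=> ab cd; rewrite -numulA (numulA (T b)).
have n0 := dconst1_neq0 (pdeg b + pdeg c).
have fin := finite_le_paths hrf (rng b) (pdeg b + pdeg c + dconst k 1).
rewrite (kpTS_expand b c n0) numul_fsuml // numul_fsumr //.
apply: spans_fsum => // e [re le].
have bn : dle (pdeg b) (pdeg b + pdeg c + dconst k 1).
  by rewrite -addrA; apply: dle_addr.
have cn : dle (pdeg c) (pdeg b + pdeg c + dconst k 1).
  exact: dle_trans (dle_addl _ _) (dle_addr _ _).
have [be|nbe] := pselect (prefix b e); last first.
  have [-> _] := kp_not_prefix le bn nbe.
  by rewrite !numul0r numulr0; apply: spans0.
have [ce|nce] := pselect (prefix c e); last first.
  have [_ ->] := kp_not_prefix le cn nce.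
  by rewrite numulr0 numul0r numulr0; apply: spans0.
case: be => x bx eE; case: ce => y cy eE'.
rewrite {1}eE kpTS_prefix // eE' kpTS_suffix //.
have -> : S a ** (S x ** T y ** T d) = S (pcomp a x) ** T (pcomp d y).
  by rewrite -kp2S ?ab // -kp2T -?cd // !numulA.
apply: spans1; rewrite /same_src !src_pcomp -?cd ?ab //.
by rewrite -(src_pcomp bx) -(src_pcomp cy) -eE -eE'.
Qed.

Lemma spans_mul x y : spans same_src x -> spans same_src y ->
  spans same_src (x ** y).
Proof.
move=> [r -> hr] [s -> hs]; rewrite /comb numul_suml.
apply: spans_sum => u ur; rewrite numul_sumr; apply: spans_sum => u' us.
rewrite -nuscaleAl -nuscaleAr; do 2 apply: spansZ.
by apply: spans_mul1; [apply: hr|apply: hs].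
Qed.

Lemma spans_subalg : subalg_closed (spans same_src).
Proof.
split; [exact: spans0| |exact: spans_mul].
by move=> t x y hx hy; apply: spansD => //; apply: spansZ.
Qed.

Definition generators : set KP :=
  [set x | (exists v, x = P v) \/ exists a, x = S a \/ x = T a].

Lemma spans_generators : generators `<=` spans same_src.
Proof.
move=> x [[v ->]|[a [|] ->]].
- have -> : P v = S (pid L v) ** T (pid L v) by rewrite kpS_pid kpT_pid kp1 eqxx.
  exact: spans1.
- rewrite -kp2SP -kpT_pid; apply: spans1; by rewrite /same_src src_pid.
- rewrite -kp2PT -kpS_pid; apply: spans1; by rewrite /same_src src_pid.
Qed.

Lemma generated_fsum G (I : choiceType) (D : set I) (f : I -> gen_alg G) :
  finite_set D ->
  val (\sum_(i \in D) f i) = \sum_(i \in D) val (f i) :> KP.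
Proof. by move=> fD; apply: fsbig_morph. Qed.

Lemma generator_P v : generated generators (P v).
Proof. by apply: generated_sub; left; exists v. Qed.

Lemma generator_S a : generated generators (S a).
Proof. by apply: generated_sub; right; exists a; left. Qed.

Lemma generator_T a : generated generators (T a).
Proof. by apply: generated_sub; right; exists a; right. Qed.

Let inG x (h : generated generators x) : gen_alg generators :=
  exist (fun z => is_true (generated generators z)) x h.

(** The family restricts to the subalgebra it generates, so universality yields a map from [KP] into
    that subalgebra. *)
Lemma generated_family : exists F : KP_family L (gen_alg generators),
  [/\ forall v, val (kpP F v) = P v, forall a, val (kpS F a) = S a
    & forall a, val (kpT F a) = T a].
Proof.
pose p v := inG (generator_P v); pose s a := inG (generator_S a).
pose t a := inG (generator_T a).
have hS v : s (pid L v) = p v by apply: val_inj; apply: kpS_pid.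
have hT v : t (pid L v) = p v by apply: val_inj; apply: kpT_pid.
have h1 v w : p v ** p w = if v == w then p v else 0.
  by apply: val_inj; rewrite [LHS](kp1 ps v w); case: eqP.
have h2S a b : src a = rng b -> s a ** s b = s (pcomp a b).
  by move=> ab; apply: val_inj; apply: (kp2S ps ab).
have h2T a b : src a = rng b -> t b ** t a = t (pcomp a b).
  by move=> ab; apply: val_inj; apply: (kp2T ps ab).
have h2PS a : p (rng a) ** s a = s a by apply: val_inj; apply: (kp2PS ps a).
have h2SP a : s a ** p (src a) = s a by apply: val_inj; apply: (kp2SP ps a).
have h2PT a : p (src a) ** t a = t a by apply: val_inj; apply: (kp2PT ps a).
have h2TP a : t a ** p (rng a) = t a by apply: val_inj; apply: (kp2TP ps a).
have h3 (n : deg k) : n != 0 -> forall a b, le_paths n a -> le_paths n b ->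
    t a ** s b = if a == b then p (src a) else 0.
  move=> n0 a b la lb; apply: val_inj; rewrite [LHS](kp3 ps n0 la lb).
  by case: eqP.
have h4 v (n : deg k) : n != 0 ->
    p v = \sum_(a \in le_paths_from v n) (s a ** t a).
  move=> n0; apply: val_inj; rewrite generated_fsum; last exact: finite_le_paths.
  exact: (kp4 ps v n0).
by exists (KPFamily hS hT h1 h2S h2T h2PS h2SP h2PT h2TP h3 h4).
Qed.

(** (KP4') inserted at [src a] for the missing degree [dsub m (pdeg b)] lengthens both paths by the
    same [c]; the extra [dconst k 1] keeps that degree nonzero. *)
Lemma spans_refine m a b : src a = src b -> dle (pdeg b + dconst k 1) m ->
  spans (fun a b => src a = src b /\ le_paths m b) (S a ** T b).
Proof.
move=> ab bm; have bm' := dle_trans (dle_addr _ _) bm.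
have n0 : dsub m (pdeg b) != 0.
  apply/eqP => /ffunP /(_ (Ordinal hk)); have := dleP _ _ bm (Ordinal hk).
  by rewrite !degE /= => h1 h2; move: h1; rewrite addn1 ltnNge -subn_eq0 h2.
rewrite -kp2SP -numulA numulA (kp4 ps _ n0).
have fin := finite_le_paths hrf (src a) (dsub m (pdeg b)).
rewrite numul_fsumr // numul_fsuml //; apply: spans_fsum => // c [rc lc].
have -> : S a ** (S c ** T c) ** T b = S (pcomp a c) ** T (pcomp b c).
  by rewrite -kp2S // -kp2T -?ab // !numulA.
apply: spans1; rewrite !src_pcomp -?ab //; split=> //.
rewrite -(dsubK bm'); apply: le_paths_pcomp => //; first exact: le_paths_deg.
by rewrite -ab.
Qed.

Hypothesis univ : KP_universal ps.

(** The map into the generated subalgebra, followed by the inclusion, carries the universal family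
    to itself, so by uniqueness it is the identity. *)
Lemma kp_spans x : spans same_src x.
Proof.
have [F [FP FS FT]] := generated_family.
have [f [[fl fm] [fP fS fT]] _] := univ F.
have [g _ gu] := univ ps.
have fx : val (f x) = x.
  have /(_ x) -> : (fun z => val (f z)) =1 g.
    apply: gu; first by split=> [c y z|y z]; rewrite ?fl ?fm.
    by split=> z; rewrite ?fP ?fS ?fT.
  by have /(_ x) <- : id =1 g by apply: gu.
rewrite -fx; have /asboolP := valP (f x); apply.
- exact: spans_subalg.
- exact: spans_generators.
Qed.

Lemma kp_normal_form x : exists m (s : seq (path L * path L)) (C : path L * path L -> R),
  [/\ uniq s, m != 0, forall u, u \in s -> src u.1 = src u.2 /\ le_paths m u.2
    & x = \sum_(u <- s) C u *: (S u.1 ** T u.2)].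
Proof.
have [r xE hr] := kp_spans x.
(* [m] exceeds the degree of every second path by at least (1,...,1), as [spans_refine] asks. *)
pose m := \sum_(u <- r) pdeg u.2.2 + dconst k 1.
have [r' xE' hr'] : spans (fun a b => src a = src b /\ le_paths m b) x.
  rewrite xE; apply: spans_sum => u ur; apply: spansZ; apply: spans_refine.
    exact: hr.
  rewrite /m (big_rem u ur) /= -addrA.
  by apply/dleP => i; rewrite !degE; lia.
have [C CE] := collect_sum (fun u => S u.1 ** T u.2) r'.
exists m, (undup [seq u.2 | u <- r']), C; split.
- exact: undup_uniq.
- exact: dconst1_neq0.
- by move=> u; rewrite mem_undup => /mapP [u' /hr' h ->].
- by rewrite xE' /comb CE.
Qed.

End KPAlgebra.

(** * Ideals *)

Section Ideals.
Variables (R : comNzRingType) (A : nuAlgType R) (I : set A).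
Hypothesis hI : is_ideal I.

Lemma idealD x y : I x -> I y -> I (x + y).
Proof.
have [I0 IB _ _] := hI; move=> Ix Iy.
by rewrite -(opprK y); apply: (IB) => //; rewrite -sub0r; apply: IB.
Qed.

Lemma ideal_sum (J : eqType) (r : seq J) (f : J -> A) :
  (forall j, j \in r -> I (f j)) -> I (\sum_(j <- r) f j).
Proof.
move=> h; rewrite big_seq; apply: big_ind => //; first by case: hI.
exact: idealD.
Qed.

End Ideals.

Lemma kernel_ideal (R : comNzRingType) (A B : nuAlgType R) (f : A -> B) :
  nualg_hom f -> is_ideal [set x | f x = 0].
Proof.
move=> [fl fm]; have f0 : f 0 = 0.
  by have := fl (-1) 0 0; rewrite scaler0 addr0 scaleN1r addNr.
split=> //=.
- move=> x y fx fy; rewrite addrC -scaleN1r fl fx fy scaler0 addr0 //.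
- by move=> x y fy; rewrite fm fy numulr0.
- by move=> x y fx; rewrite fm fx numul0r.
Qed.

(** * Ideals of KP_R(L), kernels of representations and the simplicity criteria *)

Section Simplicity.
Variables (k : nat) (L : kgraph k) (R : comNzRingType).
Hypotheses (hk : (0 < k)%N) (hlc : locally_convex L) (hrf : row_finite L).
Variables (KP : nuAlgType R) (ps : KP_family L KP).
Hypothesis univ : KP_universal ps.
Implicit Types (a b c d : path L) (v w : vertex L) (m n : deg k).
Implicit Types (I : set KP) (X Y : set (path L)).

Local Notation P := (kpP ps).
Local Notation S := (kpS ps).
Local Notation T := (kpT ps).

(** Each [b] is separated from [a] by some segment of [X]; a common extension of finitely many such
    segments separates all of them at once. *)
Lemma separate_all X a (s : seq (path L)) : ultra X -> X (pid L (src a)) ->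
  (forall b b', src b = src a -> src b' = src a -> b <> b' -> ext b X <> ext b' X) ->
  exists2 c, X c & forall b, b \in s -> src b = src a -> b <> a ->
    ~ compatible (pcomp a c) (pcomp b c).
Proof.
move=> U Xa sep; have [_ U2 _] := U.
elim: s => [|b s [c Xc IH]]; first by exists (pid L (src a)).
have [[ab ba]|h] := pselect (src b = src a /\ b <> a); last first.
  by exists c => // b'; rewrite inE => /orP[/eqP -> e ne|/IH //]; case: h.
have [] := ext_separate U Xa (esym ab); first by apply: sep => // /esym.
move=> d Xd nd; have [e Xe [ce de]] := U2 _ _ Xc Xd.
have ac : src a = rng c by rewrite (ultra_src U Xa Xc).
have ad : src a = rng d by rewrite (ultra_src U Xa Xd).
exists e => // b'; rewrite inE => /orP[/eqP -> _ _|bs ab' ba'].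
  move=> [f af bf]; apply: nd; exists f.
    by apply: prefix_trans af; apply: prefix_pcomp2.
  by apply: prefix_trans bf; apply: prefix_pcomp2; rewrite // ab.
move=> [f af bf]; apply: (IH b' bs ab' ba'); exists f.
  by apply: prefix_trans af; apply: prefix_pcomp2.
by apply: prefix_trans bf; apply: prefix_pcomp2; rewrite // ab'.
Qed.

(** Take a term at [(a, g)] with nonzero coefficient. Multiplying by [S g] on the right removes the
    terms with another second path, by (KP3'). Compressing by [T (pcomp a c)] and [S c] removes the
    other first paths, where [c] is an initial segment of an aperiodic boundary path that separates
    them from [a]. *)
Lemma ideal_vertex I x : ultra_aperiodic L -> is_ideal I -> I x -> x <> 0 ->
  exists v (t : R), t != 0 /\ I (t *: P v).
Proof.
move=> ap [_ _ Il Ir] Ix x0.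
have [m [s [C [us m0 hs xE]]]] := kp_normal_form hk hlc hrf univ x.
have [[a g] ags Cag] : exists2 u, u \in s & C u != 0.
  apply: contrapT => h; apply: x0; rewrite xE big_seq big1 // => u ur.
  have [->|Cu] := eqVneq (C u) 0; first by rewrite scale0r.
  by case: h; exists u.
have [/= ag lg] := hs _ ags.
have [X [U Xv sep]] := ap (src a).
have [c Xc nc] := separate_all [seq u.1 | u <- s] U Xv sep.
have ac : src a = rng c by rewrite (ultra_src U Xv Xc).
exists (src c), (C (a, g)); split=> //.
suff <- : T (pcomp a c) ** (x ** S g ** S c) = C (a, g) *: P (src c).
  by apply: Il; apply: (Ir); apply: Ir.
rewrite xE !numul_suml numul_sumr (bigD1_seq (a, g)) //= big_seq_cond big1 ?addr0.
  rewrite -!nuscaleAl -nuscaleAr; congr (_ *: _).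
  rewrite -(numulA (S a)) kpTS_self -ag kp2SP kp2S // kpTS_self.
  by rewrite src_pcomp.
move=> [b h] /= /andP[bhs bhag]; have [/= bh lh] := hs _ bhs.
rewrite -!nuscaleAl -nuscaleAr -(numulA (S b)) (kp3 ps m0 lh lg).
case: eqP => [hg|_]; last by rewrite numulr0 numul0r numulr0 scaler0.
have ba : src b = src a by rewrite bh hg.
rewrite -bh kp2SP kp2S ?ba // kpTS_incompatible ?scaler0 //; apply: nc => //.
  by apply/mapP; exists (b, h).
by move=> e; move/eqP: bhag; rewrite e hg.
Qed.

Lemma ideal_full I : is_ideal I -> (forall v, I (P v)) -> I = setT.
Proof.
move=> hI IP; apply/seteqP; split=> // x _.
have [r -> _] := kp_spans hk hlc hrf univ x.
apply: ideal_sum => // u _; have [_ _ _ Ir] := hI.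
by rewrite -kp2PS -numulA nuscaleAr; apply: Ir.
Qed.

(** This rests on [P (src a) = T a ** P (rng a) ** S a]. *)
Lemma ideal_hereditary I a : is_ideal I -> I (P (rng a)) -> I (P (src a)).
Proof.
move=> [_ _ Il Ir] Ia; rewrite -(kpTS_self ps a) -kp2TP -numulA.
by apply: Il; apply: Ir.
Qed.

(** (KP4') writes [P v] as the sum of the elements [S a ** P (src a) ** T a]. *)
Lemma ideal_saturated I v n : is_ideal I -> n != 0 ->
  (forall a, rng a = v -> le_paths n a -> I (P (src a))) -> I (P v).
Proof.
move=> hI n0 h; have [_ _ Il Ir] := hI.
have fin := finite_le_paths hrf v n.
rewrite (kp4 ps v n0) fsbig_finite //; apply: ideal_sum => // a.
rewrite in_fset_set // => /set_mem [ra la].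
by rewrite -kp2SP; apply: Ir; apply: Il; apply: h.
Qed.

(** If the ideal missed [P w], saturation would let a path from [w] with source outside the ideal be
    prolonged forever, giving a boundary path that stays outside by heredity. Cofinality joins [v]
    to it, a contradiction. *)
Lemma ideal_cofinal I v : cofinal L -> is_ideal I -> I (P v) -> I = setT.
Proof.
move=> /(cofinalP hlc) cf hI Iv; apply: ideal_full => // w; apply: contrapT => nw.
have n0 : dconst k 1 != 0.
  by have := dconst1_neq0 hk 0; rewrite add0r.
have [||X [U Xw XP _]] := @ultra_steps _ _ hlc w
  (fun a => ~ I (P (src a))) (fun _ _ => True); first by rewrite src_pid.
  move=> _ a _ na; apply: contrapT => h; apply: na.
  apply: (ideal_saturated hI n0) => b rb lb; apply: contrapT => nb; apply: h.
  by exists b, (dconst k 1); split; rewrite ?dle_refl ?src_pcomp.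
have [c Xc [a ra ac]] := cf X v U.
have [b Xb [[d cd bE] nb]] := XP c Xc; apply: nb.
rewrite bE src_pcomp //; apply: ideal_hereditary => //.
by rewrite -cd -ac; apply: ideal_hereditary; rewrite ?ra.
Qed.

Lemma cofinal_aperiodic_basically_simple :
  cofinal L -> aperiodic L -> basically_simple ps.
Proof.
move=> cf /(aperiodicP hlc) ap I [hI bI].
have [[x [Ix x0]]|h] := pselect (exists x, I x /\ x <> 0); last first.
  left; apply/seteqP; split=> x /=; last by move=> ->; case: hI.
  by move=> Ix; apply: contrapT => x0; apply: h; exists x.
right; have [v [t [t0 It]]] := ideal_vertex ap hI Ix x0.
by apply: (ideal_cofinal cf hI (v := v)); apply: bI It.
Qed.

(** [t *: P v] acts as [t] times the indicator of the points at [v]. For nonzero [t] this vanishes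
    only if there are no such points, and then [P v] acts as 0 too. *)
Lemma kernel_basic Z (z : path L -> int) (hZ : invariant Z) (hz : cocycle z) f :
  nualg_hom f -> KP_carries ps (rep_family R hrf hZ hz) f ->
  basic_ideal ps [set x | f x = 0].
Proof.
move=> hf [fP _ _]; split; first exact: kernel_ideal.
move=> v t t0 /=; have f0 : f 0 = 0 by case: (kernel_ideal hf).
have [fl _] := hf; have := fl t (P v) 0; rewrite f0 !addr0 fP => ->.
move=> /scale_op_eq0 [e|e]; first by rewrite e eqxx in t0.
exact: op0.
Qed.

Lemma ultra_invariant : invariant (@ultra k L).
Proof.
by split=> // X a; [apply: ext_ultra|apply: shift_ultra].
Qed.

Lemma cocycle0 : cocycle (fun _ : path L => 0 : int).
Proof. by move=> a b _; rewrite addr0. Qed.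

Lemma cocycle_deg i : cocycle (fun a : path L => (pdeg a i)%:Z).
Proof. by move=> a b ab; rewrite pdeg_pcomp // degD PoszD. Qed.

Lemma scale_vertex_neq0 (t : R) v : t != 0 -> t *: P v <> 0.
Proof.
move=> t0 e; have [f [hf hc] _] := univ (rep_family R hrf ultra_invariant cocycle0).
have := (kernel_ideal hf); move=> [f0 _ _ _]; have [fl _] := hf; have [fP _ _] := hc.
have := fl t (P v) 0; rewrite !addr0 e f0 fP addr0 => /esym/scale_op_eq0 [e'|h].
  by rewrite e' eqxx in t0.
by have [X U Xv] := ultra_exists hlc v; apply: (h (X, 0)).
Qed.

Lemma vertex_neq0 v : P v <> 0.
Proof. by rewrite -(scale1r (P v)); apply: scale_vertex_neq0; apply: oner_neq0. Qed.

Lemma rep_vertex_neq0 Z (z : path L -> int) (hZ : invariant Z) (hz : cocycle z) v X :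
  Z X -> X (pid L v) -> repP R Z v <> 0.
Proof.
move=> ZX Xv e; have : 1 *: repP R Z v = 0 by rewrite e scaler0.
move=> /scale_op_eq0 [/eqP|h]; first by rewrite oner_eq0.
by apply: (h (X, 0)).
Qed.

Lemma basically_simple_cofinal : basically_simple ps -> cofinal L.
Proof.
move=> bs; apply/(cofinalP hlc) => X v U; apply: contrapT => h.
(* The vertices [w] such that w Lambda x(n) is empty for every n, where x is the boundary path
   encoded by [X]: a hereditary set containing [v]. *)
pose H w := forall c, X c -> ~ exists2 a, rng a = w & src a = src c.
have Hv : H v by move=> c Xc e; apply: h; exists c.
have Hsrc a : H (rng a) -> H (src a).
  move=> Ha c Xc [b rb sb]; apply: (Ha c Xc).
  by exists (pcomp a b); rewrite ?rng_pcomp ?src_pcomp.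
(* The boundary paths avoiding [H]; heredity of [H] makes this set stable under prefixing. *)
pose Z := [set Y | ultra Y /\ forall b, Y b -> ~ H (src b)].
have hZ : invariant Z.
  split=> [Y []|Y a [UY YH] Ya|Y a [UY YH] Ya] //.
    split=> [|b [c [Yc ac [d bd e]]] Hb]; first exact: ext_ultra.
    apply: (YH c Yc); rewrite -(src_pcomp ac) e src_pcomp //.
    by apply: Hsrc; rewrite -bd.
  split=> [|b [ab Yb] Hb]; first exact: shift_ultra.
  by apply: (YH _ Yb); rewrite src_pcomp.
have [f [hf hc] _] := univ (rep_family R hrf hZ cocycle0).
have [fP _ _] := hc.
(* The kernel contains [P v], as [v] lies in [H], and misses [P w] for the range [w] of [X], as [X]
   itself avoids [H]. *)
have [E|E] := bs _ (kernel_basic hf hc).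
  have : [set x | f x = 0] (P v).
    rewrite /= fP; apply: op0 => -[Y n] [/= [_ YH] Yv].
    by apply: (YH _ Yv); rewrite src_pid.
  by rewrite E; apply: vertex_neq0.
have [w Xw] := ultra_rngP U.
have : [set x | f x = 0] (P w) by rewrite E.
rewrite /= fP; apply: (rep_vertex_neq0 hZ cocycle0 (X := X)) => //.
by split=> // b Xb Hb; apply: (Hb b Xb); exists (pid L (src b)); rewrite ?rng_pid ?src_pid.
Qed.

Lemma basically_simple_aperiodic : basically_simple ps -> aperiodic L.
Proof.
move=> bs; apply/(aperiodicP hlc); apply: (ultra_aperiodicP hlc) => a b ab anb.
apply: contrapT => h.
have {}h X : ultra X -> X (pid L (src a)) -> ext a X = ext b X.
  by move=> U Xa; apply: contrapT => ne; apply: h; exists X.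
(* A boundary path through [a] is a y, hence also b y with the same y. So [S a] and [S b] act with
   the same domain and the same shift. *)
have hb X : ultra X -> X a -> X b /\ shift b X = shift a X.
  move=> U Xa; have Us := shift_ultra U Xa.
  have sa : shift a X (pid L (src a)) by split; rewrite ?rng_pid // pcompp1.
  have E : X = ext b (shift a X) by rewrite -h // ext_shift.
  split; first by rewrite E; apply: ext_self => //; rewrite -ab.
  by rewrite {1}E shift_ext // -ab.
have ha X : ultra X -> X b -> X a.
  move=> U Xb; have Us := shift_ultra U Xb.
  have sb : shift b X (pid L (src b)) by split; rewrite ?rng_pid // pcompp1.
  rewrite -ab in sb; have E : X = ext a (shift b X) by rewrite h // ext_shift.
  by rewrite E; apply: ext_self.
have SE : S a = S b.
  have [f [hf hc] _] := univ (rep_family R hrf ultra_invariant cocycle0).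
  have [fP fS _] := hc; have fab : f (S a) = f (S b).
    rewrite !fS; apply: eq_op => -[X n] /=.
      by split=> -[U Xab]; split=> //; [case: (hb X U Xab)|apply: ha].
    by move=> [U Xa]; have [_ ->] := hb X U Xa.
  (* The kernel is not the whole algebra, since vertices act nontrivially; so it is zero. *)
  have [E|E] := bs _ (kernel_basic hf hc).
    apply/eqP; rewrite -subr_eq0; apply/eqP.
    have : [set x | f x = 0] (S a - S b).
      have [fl _] := hf; rewrite /= addrC -scaleN1r fl fab scaleN1r addNr //.
    by rewrite E.
  have [X U Xa] := ultra_exists hlc (src a).
  have : [set x | f x = 0] (P (src a)) by rewrite E.
  by rewrite /= fP => /(rep_vertex_neq0 ultra_invariant cocycle0 U Xa).
have [X U Xa] := ultra_exists hlc (src a).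
have Ua := ext_ultra hlc U Xa; have aa := ext_self U Xa.
have [ba _] := hb _ Ua aa.
(* With equal degrees, [a] and [b] would be the same initial segment of [ext a X]. Otherwise a
   coordinate in which the degrees differ serves as the weight. *)
have [dab|dab] := eqVneq (pdeg a) (pdeg b).
  by apply: anb; apply: ultra_uniq Ua aa ba dab.
have [i di] : exists i, pdeg a i <> pdeg b i.
  by apply/existsNP => e; move/eqP: dab; apply; apply: degP.
have [f [hf [_ fS _]] _] := univ (rep_family R hrf ultra_invariant (cocycle_deg i)).
(* At the chosen point [S a] reads [phi] at weight 0, and [S b] reads it at the nonzero weight
   [pdeg a i - pdeg b i]. *)
pose phi (t : set (path L) * int) : R^o := (t.2 == 0)%:R.
have : val (f (S a)) phi (ext a X, (pdeg a i)%:Z) =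
       val (f (S b)) phi (ext a X, (pdeg a i)%:Z) by rewrite SE.
rewrite !fS !opE; case: asboolP => [_|[]//]; case: asboolP => [_|[]//].
rewrite /phi /= subrr subr_eq0 eqxx; case: eqP => [[]//|_] /eqP.
by rewrite oner_eq0.
Qed.

(** The multiples of [t] form an ideal, nonzero by [scale_vertex_neq0], so [P v = t *: y] for some
    [y]; evaluating at a boundary path from [v] turns this into an equation in [R]. *)
Lemma simple_is_field v : simple_alg KP -> is_field R.
Proof.
move=> [_ si] t t0.
have [|E|E] := si [set x | exists y, x = t *: y].
- split.
  + by exists 0; rewrite scaler0.
  + by move=> _ _ [x ->] [y ->]; exists (x - y); rewrite scalerBr.
  + by move=> x _ [y ->]; exists (x ** y); rewrite nuscaleAr.
  + by move=> _ y [x ->]; exists (x ** y); rewrite nuscaleAl.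
- have : [set x | exists y, x = t *: y] (t *: P v) by exists (P v).
  by rewrite E => /scale_vertex_neq0.
have [y yE] : [set x | exists y, x = t *: y] (P v) by rewrite E.
have [f [hf [fP _ _]] _] := univ (rep_family R hrf ultra_invariant cocycle0).
have [X U Xv] := ultra_exists hlc v.
exists (val (f y) (fun=> 1) (X, 0)).
have [f0 _ _ _] := kernel_ideal hf; have [fl _] := hf.
have := fl t y 0; rewrite !addr0 -yE f0 addr0 fP => e.
have := congr1 (fun h : endo _ => val h (fun=> 1) (X, 0)) e.
rewrite endo_scaleE fct_scaleE opE; case: asboolP => [_ /= tE|[]//].
by rewrite mulrC -tE.
Qed.

Lemma field_ideal_basic I : is_field R -> is_ideal I -> basic_ideal ps I.
Proof.
move=> fld hI; split=> // v t /fld [d dt] It; have [_ _ Il _] := hI.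
(* Closure under scalars is not part of [is_ideal], so the scalar [d] enters through multiplication
   by [d *: P v]. *)
have -> : P v = (d *: P v) ** (t *: P v).
  by rewrite -nuscaleAr -nuscaleAl scalerA mulrC dt scale1r kp1 eqxx.
exact: Il.
Qed.

End Simplicity.

(** Without vertices [KP] is zero and not simple, while cofinality and aperiodicity hold vacuously;
    hence the inhabited vertex set in the second part. *)
Theorem theorem8p5 (k : nat) (hk : (0 < k)%N) (L : kgraph k)
    (R : comNzRingType) (hlc : locally_convex L) (hrf : row_finite L)
    (KP : nuAlgType R) (ps : KP_family L KP) (univ : KP_universal ps) :
  (basically_simple ps <-> cofinal L /\ aperiodic L) /\
  (inhabited (vertex L) ->
    (simple_alg KP <-> (cofinal L /\ aperiodic L) /\ is_field R)).
Proof.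
have bsP : basically_simple ps <-> cofinal L /\ aperiodic L.
  split=> [bs|[cf ap]]; last exact: cofinal_aperiodic_basically_simple.
  split; first exact: basically_simple_cofinal bs.
  exact: basically_simple_aperiodic bs.
split=> // -[v]; split=> [si|[/bsP bs fld]].
  split; last exact: simple_is_field v si.
  by apply/bsP => I [hI _]; case: si => _; apply.
split; last by move=> I hI; apply: bs; apply: field_ideal_basic.
exists (kpP ps v), (kpP ps v); rewrite kp1 eqxx.
exact: vertex_neq0 univ v.
Qed.
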